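(* For all integers $k>\ell\ge 2$, zero is an accumulation point of the set $\Pi_\ell^k=\{\pi_\ell(F): F \text{ is a } k\text{-graph}\}\subseteq[0,1]$.
   Context: A $k$-graph is a finite $k$-uniform hypergraph. For a $k$-graph $H$ and $S\subseteq V(H)$ with $|S|<k$, the degree $d_H(S)$ is the number of edges of $H$ containing $S$; the minimum $\ell$-degree $\delta_\ell(H)$ is the minimum of $d_H(S)$ over all $\ell$-subsets $S$ of $V(H)$. $H$ is $F$-free if it contains no copy of $F$ as a (not necessarily induced) subhypergraph. For $1\le \ell<k$ and a $k$-graph $F$, $\mathrm{ex}_\ell(n,F)$ is the maximum of $\delta_\ell(H)$ over all $n$-vertex $F$-free $k$-graphs $H$, and $\pi_\ell(F)=\lim_{n\to\infty}\mathrm{ex}_\ell(n,F)/\binom{n-\ell}{k-\ell}$ (this limit is known to exist). *)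

(* Defs.v *)
From HB Require Import structures.
From mathcomp Require Import all_boot all_order all_algebra.
From mathcomp Require Import all_classical all_reals all_analysis.

Set Implicit Arguments.
Unset Strict Implicit.
Unset Printing Implicit Defensive.

Import Order.TTheory GRing.Theory Num.Theory.
Import numFieldNormedType.Exports.

Local Open Scope classical_set_scope.
Local Open Scope ring_scope.

Record kgraph (k : nat) (V : finType) := KGraph {
  edges : {set {set V}};
  edges_uniform : [forall e in edges, #|e| == k]%N
}.

HB.instance Definition _ (k : nat) (V : finType) :=
  [isSub for @edges k V].
#[hnf] HB.instance Definition _ (k : nat) (V : finType) :=
  [Finite of kgraph k V by <:].

Definition degree (k : nat) (V : finType) (H : kgraph k V) (S : {set V}) : nat :=
  #|[set e in edges H | S \subset e]|.

(* Every degree is at most #|edges H|, so this neutral element does not affect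
   the minimum as soon as V has an l-subset. *)
Definition min_degree (l k : nat) (V : finType) (H : kgraph k V) : nat :=
  \big[minn/#|edges H|]_(S : {set V} | #|S| == l) degree H S.

Definition is_free (k : nat) (V W : finType) (F : kgraph k V) (H : kgraph k W)
    : bool :=
  ~~ [exists f : {ffun V -> W},
        injectiveb f && [forall e in edges F, (f @: e)%SET \in edges H]].

(* If no k-graph on n vertices is F-free, which for large n happens only when F
   has no edge, the maximum is 0. *)
Definition ex (l n k : nat) (V : finType) (F : kgraph k V) : nat :=
  \max_(H : kgraph k 'I_n | is_free F H) min_degree l H.

Definition ex_ratio (R : realType) (l k : nat) (V : finType) (F : kgraph k V)
    : R^nat :=
  fun n => (ex l n F)%:R / 'C(n - l, k - l)%:R.

Definition turan_density (R : realType) (l k : nat) (V : finType)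
    (F : kgraph k V) : R :=
  limn (ex_ratio R l F).

(* [lim] has a default value on divergent sequences, whence the explicit
   convergence requirement. *)
Definition turan_densities (R : realType) (l k : nat) : set R :=
  [set x | exists (V : finType) (F : kgraph k V),
             cvgn (ex_ratio R l F) /\ x = turan_density R l F].
Arguments turan_densities : clear implicits.

(* Main.v *)
Require Import Defs.
From mathcomp Require Import all_boot all_order all_fingroup all_algebra.
From mathcomp Require Import all_classical all_reals all_analysis.
From mathcomp Require Import zify ring lra.
Import numFieldNormedType.Exports.

Set Implicit Arguments.
Unset Strict Implicit.
Unset Printing Implicit Defensive.

Import Order.TTheory GRing.Theory Num.Theory.

(** Write d = k - l.  Two opposite facts about one hypergraph F are needed: every
large k-graph whose l-degrees have density at least eps contains F, and yet the
density of F is positive.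

The first fact is arranged by taking products.  A k-graph G on m vertices is
called rich here if the link of each l-set contains a complete d-partite d-graph
with parts of size s.  Let F be the categorical product of all rich k-graphs on m
vertices, m being large: its vertices are the families (x_G) indexed by G, and a
k-set is an edge if each projection maps it to an edge of the corresponding G.
If H is large and has l-degrees of density eps, then at least half of all maps
from m points to H are injective and pull H back to a k-graph with l-degrees of
density eps/2 ([sampling]), hence to a rich one ([rich_of_degree]); some rich G is
thus induced by a positive proportion of all maps, so H contains a large blow-up
of G ([dense_box]), and F embeds into that blow-up by its projection to G
([rich_product_in_box]).

The second fact uses only that F is recurrent: there is a nonempty family of
s-sets of vertices, the states, such that each l-subset of a state is completed
to edges by all transversals of suitable d further states
([rich_product_recurrent]).  Colour the n vertices by residues modulo N, where N
exceeds the order of F, and keep the k-sets e such that, whenever l vertices of e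
share the colour x, the colour x+1 occurs in e, and such that the colour 0 occurs
in e if no l vertices share a colour.  As l >= 2, each l-set extends to a positive
proportion of its supersets ([pattern_degree]).  In a copy of F, a state with l
vertices of colour x leads to a state entirely of colour x+1, since otherwise a
transversal avoiding that colour would violate the rule; some state has l vertices
of one colour by the clause about 0; so all N colours occur on F, which has too
few vertices ([recurrent_colours]).

That the limit defining the density exists also follows from [sampling]: a dense
F-free hypergraph on n vertices has an almost as dense induced subhypergraph on m
vertices, for each large m ([ex_ratio_almost_nonincreasing]).  Sampling requires
that the degrees of all l-sets be controlled at once, hence an exponential tail
bound, proved in [hits_tail] by Hoeffding's device of averaging over families of
disjoint blocks. *)

(** * Boxes in dense sets of tuples *)

Definition fcons (V : finType) (q : nat) (x : V) (y : {ffun 'I_q -> V})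
    : {ffun 'I_q.+1 -> V} :=
  [ffun i => if unlift ord0 i is Some j then y j else x].

Lemma fcons_inj (V : finType) (q : nat) (x : V) : injective (@fcons V q x).
Proof.
move=> y z /ffunP yz; apply/ffunP => i; have := yz (lift ord0 i).
by rewrite !ffunE liftK.
Qed.

Lemma card_fcons (V : finType) (q : nat) (B : {set {ffun 'I_q.+1 -> V}}) :
  #|B| = \sum_x #|[set y | fcons x y \in B]|.
Proof.
rewrite -sum1_card (partition_big (fun b : {ffun _ -> _} => b ord0) predT) //=.
apply: eq_bigr => x _; rewrite -(card_imset _ (@fcons_inj V q x)) -sum1_card.
apply: eq_bigl => b; apply/andP/imsetP => [[bB /eqP bx]|[y]].
  have bE : b = fcons x [ffun j => b (lift ord0 j)].
    by apply/ffunP => i; rewrite ffunE; case: unliftP => [j|] ->; rewrite ?ffunE.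
  by exists [ffun j => b (lift ord0 j)]; rewrite // inE -bE.
by rewrite inE => yB ->; split=> //; rewrite ffunE unlift_none.
Qed.

Lemma pigeonhole_sum (I : finType) (P : pred I) (F : I -> nat) (c : nat) :
  0 < c -> c <= \sum_(i | P i) F i -> exists2 i, P i & c <= #|P| * F i.
Proof.
move=> c_gt0 cF; case: (pickP P) => [i0 Pi0|P0]; last first.
  by move: cF; rewrite big_pred0 // leqNgt c_gt0.
have [i Pi maxi] := @arg_maxnP _ i0 P F Pi0.
exists i => //; apply: leq_trans cF _; rewrite -sum_nat_const.
exact: leq_sum.
Qed.

Lemma union_bound (I T : finType) (P : pred I) (F : I -> {set T}) (A : {set T}) :
  (forall y, y \in A -> exists2 i, P i & y \in F i) ->
  #|A| <= \sum_(i | P i) #|F i|.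
Proof.
move=> cover; apply: leq_trans (_ : #|\bigcup_(i | P i) F i| <= _).
  by apply/subset_leq_card/fintype.subsetP => y /cover[i Pi yi]; apply/bigcupP; exists i.
elim/big_rec2: _ => [|i m X _ IH]; first by rewrite cards0.
by rewrite cardsU (leq_trans (leq_subr _ _)) // leq_add2l.
Qed.

Lemma subset_of_card (T : finType) (A : {set T}) (w : nat) :
  w <= #|A| -> exists2 W : {set T}, W \subset A & #|W| = w.
Proof.
rewrite cardE => wA; exists [set x in take w (enum A)].
  by apply/fintype.subsetP => x; rewrite inE => /mem_take; rewrite mem_enum.
by rewrite cardsE (card_uniqP _) ?take_uniq ?enum_uniq // size_takel.
Qed.

Lemma injection_into (T : finType) (X : {set T}) (t : nat) :
  #|X| = t -> exists2 p : 'I_t -> T, injective p & forall i, p i \in X.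
Proof.
move=> <-; exists (fun i => enum_val i) => [|i]; first exact: enum_val_inj.
exact: enum_valP.
Qed.

(** Columns that are not heavy account for at most half of the total, so that the
heavy ones cannot be few. *)
Lemma many_heavy_columns (V Y : finType) (D : V -> {set Y}) (C w : nat) :
  2 * C * w < #|V| -> 0 < #|Y| -> #|V| * #|Y| <= C * \sum_x #|D x| ->
  exists2 W : {set V}, #|W| = w & forall x, x \in W -> #|Y| <= 2 * C * #|D x|.
Proof.
move=> Vbig Y_gt0 dense; pose heavy := [set x | #|Y| <= 2 * C * #|D x|].
case: (leqP w #|heavy|) => [/subset_of_card [W /fintype.subsetP Wh Ww]|few].
  by exists W => // x /Wh; rewrite inE.
suff : 2 * C * \sum_x #|D x| < 2 * (#|V| * #|Y|) by lia.
have -> : \sum_x #|D x| =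
    \sum_(x in heavy) #|D x| + \sum_(x | x \notin heavy) #|D x|.
  by rewrite (bigID (mem heavy)).
rewrite mulnDr.
have h1 : 2 * C * \sum_(x in heavy) #|D x| <= 2 * C * (w * #|Y|).
  rewrite leq_mul2l; apply/orP; right.
  apply: leq_trans (_ : \sum_(x in heavy) #|Y| <= _).
    by apply: leq_sum => x _; apply: max_card.
  by rewrite sum_nat_const leq_mul2r (ltnW few) orbT.
have h2 : 2 * C * (\sum_(x | x \notin heavy) #|D x|) <= #|V| * #|Y|.
  rewrite big_distrr /=.
  apply: leq_trans (_ : \sum_(x | x \notin heavy) #|Y| <= _).
    by apply: leq_sum => x; rewrite inE -ltnNge => /ltnW.
  by rewrite sum_nat_const leq_mul2r max_card orbT.
nia.
Qed.

(** Only boundedly many heavy columns are retained, so that there are boundedly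
many candidates for X; a point y lying in many of these columns lies in t of them,
and the pigeonhole principle picks X. *)
Lemma common_neighbours (V Y : finType) (D : V -> {set Y}) (C t : nat) :
  2 * C * (4 * C * t) < #|V| -> 0 < #|Y| -> 0 < t -> 0 < C ->
  #|V| * #|Y| <= C * \sum_x #|D x| ->
  exists2 X : {set V}, #|X| = t &
    #|Y| <= 4 * C * 2 ^ (4 * C * t) * #|[set y | [forall x in X, y \in D x]]|.
Proof.
move=> Vbig Y0 t0 C0 dense; set w := 4 * C * t.
have [W Ww Wheavy] := many_heavy_columns Vbig Y0 dense; rewrite -/w in Ww.
pose N y := [set x in W | y \in D x].
pose Y' := [set y | t <= #|N y|].
have double : \sum_(x in W) #|D x| = \sum_y #|N y|.
  rewrite (eq_bigr (fun x => \sum_(y in D x) 1)) => [|x _]; last by rewrite sum1_card.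
  rewrite (exchange_big_dep predT) //=; apply: eq_bigr => y _.
  by rewrite sum1dep_card.
(* Count pairs (x, y) with x in W and y in D x. *)
have lower : w * #|Y| <= 2 * C * \sum_(x in W) #|D x|.
  by rewrite big_distrr /= -Ww -sum_nat_const leq_sum.
have upper : \sum_y #|N y| <= t * #|Y| + w * #|Y'|.
  rewrite (bigID (mem Y')) /= addnC leq_add //.
    apply: leq_trans (_ : \sum_(y | y \notin Y') t <= _).
      by apply: leq_sum => y; rewrite inE -ltnNge => /ltnW.
    by rewrite sum_nat_const mulnC leq_mul2l max_card orbT.
  apply: leq_trans (_ : \sum_(y in Y') w <= _).
    by apply: leq_sum => y _; rewrite -Ww subset_leq_card //;
       apply/fintype.subsetP => x; rewrite inE => /andP[].
  by rewrite sum_nat_const mulnC.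
have Y'big : #|Y| <= 4 * C * #|Y'|.
  move: lower; rewrite double => lower.
  have : w * #|Y| <= 2 * C * (t * #|Y| + w * #|Y'|).
    by apply: leq_trans lower _; rewrite leq_mul2l upper orbT.
  have -> : w * #|Y| = 2 * C * t * (2 * #|Y|) by rewrite /w; ring.
  have -> : 2 * C * (t * #|Y| + w * #|Y'|) = 2 * C * t * (#|Y| + 4 * C * #|Y'|).
    by rewrite /w; ring.
  rewrite leq_pmul2l ?muln_gt0 ?C0 ?t0 //; lia.
pose nb (X : {set V}) := [set y | [forall x in X, y \in D x]].
have cover : #|Y'| <= \sum_(X in [set X in powerset W | #|X| == t]) #|nb X|.
  apply: union_bound => y; rewrite inE => /subset_of_card [X /fintype.subsetP XN /eqP Xt].
  exists X.
    by rewrite !inE Xt andbT; apply/fintype.subsetP => x /XN; rewrite inE => /andP[].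
  by rewrite inE; apply/forall_inP => x /XN; rewrite inE => /andP[].
have Y'0 : 0 < #|Y'| by move: Y'big; case: #|Y'| => // ; lia.
have [X] := pigeonhole_sum Y'0 cover.
rewrite !inE => /andP[_ /eqP Xt] XY; exists X => //.
apply: leq_trans Y'big _; rewrite -[leqRHS]mulnA leq_mul2l; apply/orP; right.
apply: leq_trans XY _; rewrite leq_mul2r; apply/orP; right.
rewrite -Ww -card_powerset; apply: subset_leq_card.
by apply/fintype.subsetP => Z; rewrite inE => /andP[].
Qed.

(** This is the theorem of Erdos on complete q-partite subhypergraphs, by induction
on q: [common_neighbours] fixes t values of the first coordinate for which a
positive proportion of the remaining tuples can be used simultaneously. *)
Lemma dense_box (q t C : nat) : exists n0, forall V : finType, n0 <= #|V| ->
  forall B : {set {ffun 'I_q -> V}}, #|V| ^ q <= C * #|B| ->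
  exists2 p : 'I_q -> 'I_t -> V, forall i, injective (p i) &
    forall a : 'I_q -> 'I_t, [ffun i => p i (a i)] \in B.
Proof.
have [->|t_gt0] := posnP t.
  elim: q C => [|q _] C; last first.
    exists 0 => V _ B _; exists (fun _ (x : 'I_0) => match notF (ltn_ord x) with end).
      by move=> i [].
    by move=> a; case: (a ord0).
  exists 0 => V _ B; rewrite expn0 muln_gt0 card_gt0 => /andP[_ /set0Pn[b bB]].
  exists (fun _ (x : 'I_0) => match notF (ltn_ord x) with end) => [[]|a] //.
  by rewrite (_ : [ffun _ => _] = b) //; apply/ffunP => -[].
elim: q C => [|q IHq] C.
  exists 1 => V /card_gt0P[v _] B.
  rewrite expn0 muln_gt0 card_gt0 => /andP[_ /set0Pn[b bB]].
  exists (fun (i : 'I_0) _ => match notF (ltn_ord i) with end) => [[]|a] //.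
  by rewrite (_ : [ffun _ => _] = b) //; apply/ffunP => -[].
have [->|C_gt0] := posnP C.
  by exists 1 => V V1 B; rewrite leqNgt expn_gt0 V1.
have [n0 IH] := IHq (4 * C * 2 ^ (4 * C * t)).
exists (maxn n0 (2 * C * (4 * C * t)).+1) => V; rewrite geq_max => /andP[n0V Vbig] B dense.
have cY : #|{: {ffun 'I_q -> V}}| = #|V| ^ q by rewrite card_ffun card_ord.
have [||X Xt] := @common_neighbours V {ffun 'I_q -> V}
    (fun x => [set y | fcons x y \in B]) C t Vbig _ t_gt0 C_gt0.
- by rewrite cY expn_gt0 (leq_trans _ Vbig).
- by rewrite cY -expnS -card_fcons.
rewrite cY => /(IH V n0V)[p pinj pbox].
have [p0 p0inj p0X] := injection_into Xt.
exists (fun i => if unlift ord0 i is Some j then p j else p0) => [i|a].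
  by case: unliftP.
have := pbox (fun j => a (lift ord0 j)); rewrite inE => /forall_inP /(_ _ (p0X (a ord0))).
rewrite inE; congr (_ \in B); apply/ffunP => i; rewrite !ffunE.
by case: unliftP => [j|] ->; rewrite ?ffunE.
Qed.

(** * Averaging over injections and over independent blocks *)

Definition pull (D W V : finType) (p : D -> W) (g : {ffun W -> V}) : {ffun D -> V} :=
  [ffun j => g (p j)].

Definition injections (D W : finType) : {set {ffun D -> W}} :=
  [set f : {ffun D -> W} | injectiveb f].

(** The symmetric group acts transitively on injections with a given domain; this is
what makes the fibres in [sum_over_injections] equinumerous. *)
Lemma perm_between_injections (D W : finType) (h h' : D -> W) :
  injective h -> injective h' -> exists tau : {perm W}, forall j, tau (h j) = h' j.
Proof.
move=> hinj h'inj.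
suff [tau tauE] : exists tau : {perm W}, forall j, j \in enum D -> tau (h j) = h' j.
  by exists tau => j; apply: tauE; rewrite mem_enum.
elim: (enum D) => [|j s [tau tauE]]; first by exists 1%g.
exists (tau * tperm (tau (h j)) (h' j))%g => i; rewrite inE permM => /predU1P[->|si].
  by rewrite tpermL.
have [->|ij] := eqVneq i j; first by rewrite tpermL.
rewrite tpermD ?(tauE i) //; last by rewrite (inj_eq h'inj) eq_sym.
by rewrite -(tauE i) // (inj_eq perm_inj) (inj_eq hinj) eq_sym.
Qed.

(** Restricting a random injection along p yields a uniformly distributed
injection, all fibres of the restriction having the same size. *)
Lemma sum_over_injections (D E W : finType) (p : D -> E) (f : {ffun D -> W} -> nat) :
  injective p ->
  #|injections D W| * \sum_(b in injections E W) f (pull p b) =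
  #|injections E W| * \sum_(h in injections D W) f h.
Proof.
move=> pinj.
pose N h := #|[set b in injections E W | pull p b == h]|.
have pull_inj b : b \in injections E W -> pull p b \in injections D W.
  rewrite !inE => /injectiveP binj; apply/injectiveP => i j.
  by rewrite !ffunE => /binj/pinj.
have N_le h h' : h \in injections D W -> h' \in injections D W -> N h <= N h'.
  rewrite !inE => /injectiveP hinj /injectiveP h'inj.
  have [tau tauE] := perm_between_injections hinj h'inj.
  pose mv (b : {ffun E -> W}) := [ffun e => tau (b e)].
  have mv_inj : injective mv.
    by move=> b c /ffunP bc; apply/ffunP => e; have := bc e; rewrite !ffunE => /perm_inj.
  rewrite /N -(card_imset _ mv_inj); apply/subset_leq_card/fintype.subsetP => c.
  case/imsetP => b; rewrite !inE => /andP[/injectiveP binj /eqP bh] ->.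
  apply/andP; split; first by apply/injectiveP => e e'; rewrite !ffunE => /perm_inj/binj.
  by apply/eqP/ffunP => j; rewrite !ffunE -tauE -bh ffunE.
have sumN (F : {ffun D -> W} -> nat) :
    \sum_(b in injections E W) F (pull p b) = \sum_(h in injections D W) N h * F h.
  rewrite (partition_big (fun b => pull p b) (mem (injections D W))) //=.
  apply: eq_bigr => h _; rewrite /N -sum1dep_card big_distrl /=.
  by apply: eq_bigr => b /andP[_ /eqP ->]; rewrite mul1n.
have [h0 h0i|none] := pickP (mem (injections D W)); last first.
  by rewrite [X in _ = _ * X]big_pred0 // (eq_card0 none) mul0n muln0.
have NE h : h \in injections D W -> N h = N h0.
  by move=> hi; apply/eqP; rewrite eqn_leq !N_le.
have -> : #|injections E W| = #|injections D W| * N h0.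
  rewrite -sum1_card (sumN (fun=> 1)) -sum_nat_const.
  by apply: eq_bigr => h /NE ->; rewrite muln1.
rewrite sumN -mulnA; congr (_ * _); rewrite big_distrr /=.
by apply: eq_bigr => h /NE ->.
Qed.

Lemma card_pull_fibre (E W V : finType) (p : E -> W) (f : {ffun E -> V}) :
  injective p -> #|[set g | pull p g == f]| = #|V| ^ (#|W| - #|E|).
Proof.
move=> pinj.
pose F (x : W) : pred V := if [pick e | p e == x] is Some e then pred1 (f e) else predT.
have -> : #|[set g | pull p g == f]| = #|(family F : simpl_pred {ffun W -> V})|.
  apply: eq_card => g; rewrite inE; apply/eqP/familyP => [gf x|gF].
    rewrite /F; case: pickP => [e /eqP <-|//].
    by rewrite -gf !inE ffunE.
  apply/ffunP => e; rewrite ffunE; have := gF (p e); rewrite /F.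
  case: pickP => [e' /eqP/pinj ->|/(_ e)]; last by rewrite eqxx.
  by rewrite inE => /eqP.
rewrite card_family foldrE big_map big_enum /= (bigID (mem (codom p))) /=.
rewrite big1 => [|x /codomP[e ->]]; last first.
  rewrite /F; case: pickP => [e' _|/(_ e)]; last by rewrite eqxx.
  by rewrite card1.
rewrite mul1n (eq_bigr (fun=> #|V|)) => [|x xp]; last first.
  rewrite /F; case: pickP => [e' /eqP ex|_]; last by apply: eq_card.
  by rewrite -ex codom_f in xp.
rewrite prod_nat_const -(card_codom pinj); congr (_ ^ _).
by rewrite -(cardC (mem (codom p))) addKn; apply: eq_card.
Qed.

Local Open Scope ring_scope.

Lemma sum_over_pulls (R : pzSemiRingType) (E W V : finType) (p : E -> W)
    (F : {ffun E -> V} -> R) : injective p ->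
  \sum_g F (pull p g) = (\sum_f F f) *+ (#|V| ^ (#|W| - #|E|)).
Proof.
move=> pinj; rewrite (partition_big (fun g => pull p g) predT) //= -sumrMnl.
apply: eq_bigr => f _; rewrite -(card_pull_fibre f pinj).
rewrite (eq_bigr (fun=> F f)) => [|g /eqP -> //].
by rewrite -sumr_const; apply: eq_bigl => g; rewrite inE.
Qed.

(** Independence of the b blocks of a random function on [b x D]. *)
Lemma sum_over_blocks (R : comPzSemiRingType) (b : nat) (D V : finType)
    (w : {ffun D -> V} -> R) :
  \sum_(f : {ffun 'I_b * D -> V}) \prod_(i < b) w (pull (pair i) f) =
  (\sum_a w a) ^+ b.
Proof.
rewrite -[X in _ ^+ X]card_ord -prodr_const bigA_distr_bigA.
pose unc (F : {ffun 'I_b -> {ffun D -> V}}) := [ffun e : 'I_b * D => F e.1 e.2].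
pose cur (f : {ffun 'I_b * D -> V}) := [ffun i : 'I_b => pull (pair i) f].
rewrite (reindex unc) /=; last first.
  exists cur => f _; first by apply/ffunP => i; apply/ffunP => j; rewrite !ffunE.
  by apply/ffunP => -[i j]; rewrite !ffunE.
apply: eq_bigr => F _; apply: eq_bigr => i _; congr w.
by apply/ffunP => j; rewrite !ffunE.
Qed.

(** Jensen's inequality, from the tangent of the exponential at the mean. *)
Lemma expR_mean_le (R : realType) (I : finType) (B : {set I}) (x : I -> R) :
  (0 < #|B|)%N ->
  expR ((\sum_(i in B) x i) / #|B|%:R) * #|B|%:R <= \sum_(i in B) expR (x i).
Proof.
move=> B0; set m := _ / _.
have tangent i : expR m * (1 + (x i - m)) <= expR (x i).
  rewrite -[in leRHS](subrKC m (x i)) expRD ler_wpM2l ?expR_ge0 //.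
  exact: expR_ge1Dx.
apply: le_trans (ler_sum _ (fun i _ => tangent i)).
rewrite -big_distrr /= big_split /= sumrB !sumr_const -mulr_natr.
rewrite -[m *+ _]mulr_natr {3}/m divfK ?pnatr_eq0 -?lt0n //.
by rewrite subrr addr0.
Qed.

(** * An exponential tail bound *)

(** Up to ordering of tuples, this will be the degree of an l-set in a sample. *)
Definition hits (W V : finType) (d : nat) (A : {set {ffun 'I_d -> V}})
    (g : {ffun W -> V}) : nat :=
  #|[set h in injections 'I_d W | pull h g \in A]|.

Lemma expRN_quadratic (R : realType) (x : R) : 0 <= x -> expR (- x) <= 1 - x + x ^+ 2.
Proof.
move=> x0; have e1 : 1 + x <= expR x by apply: expR_ge1Dx.
rewrite expRN; apply: le_trans (_ : (1 + x)^-1 <= _).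
  by rewrite lef_pV2 ?posrE ?expR_gt0 //; lra.
rewrite -[leLHS]mul1r ler_pdivrMr; last lra.
nra.
Qed.

(** For a fixed family q of disjoint blocks, the events that g maps the blocks into A
are independent, so that the moment generating function is a product. *)
Lemma block_mgf (R : realType) (W V : finType) (d b : nat)
    (A : {set {ffun 'I_d -> V}}) (beta lam : R) (q : {ffun 'I_b * 'I_d -> W}) :
  0 <= lam -> q \in injections ('I_b * 'I_d)%type W ->
  beta * (#|V| ^ d)%:R <= #|A|%:R ->
  \sum_(g : {ffun W -> V})
     expR (- lam * (\sum_(i < b) (pull (pair i) (pull q g) \in A))%:R) <=
  expR (- (1 - expR (- lam)) * beta * b%:R) * (#|V| ^ #|W|)%:R.
Proof.
move=> lam0; rewrite inE => /injectiveP qinj dense.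
pose w (a : {ffun 'I_d -> V}) : R := expR (- lam * (a \in A)%:R).
rewrite (eq_bigr (fun g => \prod_(i < b) w (pull (pair i) (pull q g)))); last first.
  by move=> g _; rewrite natr_sum mulr_sumr expR_sum.
rewrite (sum_over_pulls (fun f => \prod_(i < b) w (pull (pair i) f)) qinj).
rewrite sum_over_blocks card_prod !card_ord.
have bdW : (b * d <= #|W|)%N.
  by have := leq_card _ qinj; rewrite card_prod !card_ord.
set th := 1 - expR (- lam).
have sumw : \sum_a w a = (#|V| ^ d)%:R - th * #|A|%:R.
  rewrite (bigID (mem A)) /=.
  rewrite (eq_bigr (fun=> expR (- lam))) => [|a aA]; last by rewrite /w aA mulr1.
  rewrite [X in _ + X](eq_bigr (fun=> 1)) => [|a aA]; last first.
    by rewrite /w (negbTE aA) mulr0 expR0.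
  rewrite !sumr_const.
  have -> : (#|V| ^ d = #|A| + #|[predC A]|)%N.
    by rewrite cardC card_ffun card_ord.
  rewrite natrD -[expR (- lam) *+ _]mulr_natr /th.
  rewrite (_ : #|[pred x | x \notin A]| = #|[predC A]|) //; ring.
have th0 : 0 <= th by rewrite subr_ge0 -expR0 ler_expR oppr_le0.
have sumw_le : \sum_a w a <= expR (- th * beta) * (#|V| ^ d)%:R.
  apply: le_trans (_ : (1 + (- th * beta)) * (#|V| ^ d)%:R <= _); last first.
    by rewrite ler_wpM2r ?ler0n // expR_ge1Dx.
  rewrite sumw [leRHS]mulrDl mul1r lerD2l !mulNr lerN2 -mulrA ler_wpM2l //.
have sumw0 : 0 <= \sum_a w a by apply: sumr_ge0 => a _; apply: expR_ge0.
rewrite -mulr_natr.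
apply: le_trans (_ : (expR (- th * beta) * (#|V| ^ d)%:R) ^+ b *
   (#|V| ^ (#|W| - b * d))%:R <= _).
  by rewrite ler_wpM2r ?ler0n // lerXn2r ?nnegrE ?mulr_ge0 ?expR_ge0.
rewrite exprMn -expRM_natr -[leLHS]mulrA -natrX -natrM -expnM -expnD.
by rewrite (mulnC d) subnKC.
Qed.

(** The proportion of the injections that g maps into A is the average, over all
families q of b disjoint blocks, of the proportion of the blocks of q mapped into A.
Jensen's inequality thus bounds its moment generating function by that of b
independent trials. *)
Lemma hits_tail (R : realType) (W V : finType) (d b : nat)
    (A : {set {ffun 'I_d -> V}}) (beta eta : R) :
  (b * d <= #|W|)%N -> 0 < eta -> beta <= 1 ->
  beta * (#|V| ^ d)%:R <= #|A|%:R ->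
  #|[set g : {ffun W -> V} |
      (hits A g)%:R < (beta - eta) * #|injections 'I_d W|%:R]|%:R <=
  expR (- (eta ^+ 2 / 4) * b%:R) * (#|V| ^ #|W|)%:R.
Proof.
move=> bdW eta0 beta1 dense; set bad := [set g | _].
have [b0|b0] := posnP b.
  rewrite b0 mulr0 expR0 mul1r ler_nat -card_ffun max_card //.
(* This value of lam minimises the bound lam^2 - lam * eta for the exponent. *)
pose lam := eta / 2; pose E := ('I_b * 'I_d)%type.
have lam0 : 0 <= lam by rewrite /lam; lra.
pose Y (g : {ffun W -> V}) (q : {ffun E -> W}) :=
  (\sum_(i < b) (pull (pair i) (pull q g) \in A))%N.
have nE : (0 < #|injections E W|)%N.
  by rewrite /injections card_inj_ffuns ffact_gt0 card_prod !card_ord.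
have nD : (0 < #|injections 'I_d W|)%N.
  by rewrite /injections card_inj_ffuns ffact_gt0 card_ord; nia.
have Ysum g : (#|injections 'I_d W| * \sum_(q in injections E W) Y g q =
   #|injections E W| * (b * hits A g))%N.
  rewrite exchange_big /= big_distrr /= [RHS]mulnCA.
  rewrite -[X in _ = (X * _)%N]card_ord -sum_nat_const; apply: eq_bigr => i _.
  have pinj : injective (pair i : 'I_d -> E) by move=> x y [].
  have -> : (\sum_(q in injections E W) (pull (pair i) (pull q g) \in A) =
      \sum_(q in injections E W) (pull (pull (pair i) q) g \in A))%N.
    by apply: eq_bigr => q _; congr (nat_of_bool (_ \in A)); apply/ffunP => j; rewrite !ffunE.
  rewrite (sum_over_injections (fun h => nat_of_bool (pull h g \in A)) pinj).
  by congr (_ * _)%N; rewrite /hits -sum1dep_card big_mkcondr.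
pose x (g : {ffun W -> V}) : R := - lam * b%:R * ((hits A g)%:R / #|injections 'I_d W|%:R).
have jensen g : expR (x g) * #|injections E W|%:R <=
    \sum_(q in injections E W) expR (- lam * (Y g q)%:R).
  apply: le_trans (expR_mean_le (fun q => - lam * (Y g q)%:R) nE).
  rewrite ler_wpM2r ?ler0n // ler_expR -mulr_sumr -natr_sum /x.
  have /(congr1 (fun n => n%:R : R)) := Ysum g.
  rewrite !natrM; set S := (\sum_(q in _) _)%N => eqS.
  have nD' : #|injections 'I_d W|%:R != 0 :> R by rewrite pnatr_eq0 -lt0n.
  have nE' : #|injections E W|%:R != 0 :> R by rewrite pnatr_eq0 -lt0n.
  rewrite -[leRHS]mulrA.
  suff -> : S%:R / #|injections E W|%:R =
     b%:R * ((hits A g)%:R / #|injections 'I_d W|%:R) :> R.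
    by rewrite [leRHS]mulrA.
  apply: (mulfI nD'); rewrite [LHS]mulrA eqS; field.
  by rewrite nE' nD'.
set th := 1 - expR (- lam).
(* Sum the Jensen bound over g and exchange the sums. *)
have mass : \sum_g expR (x g) <= expR (- th * beta * b%:R) * (#|V| ^ #|W|)%:R.
  have nE' : 0 < #|injections E W|%:R :> R by rewrite ltr0n.
  rewrite -(ler_pM2r nE') mulr_suml.
  apply: le_trans (ler_sum _ (fun g _ => jensen g)) _.
  rewrite exchange_big /= [leRHS]mulr_natr -sumr_const.
  by apply: ler_sum => q qi; apply: block_mgf.
have markov : #|bad|%:R * expR (- lam * b%:R * (beta - eta)) <= \sum_g expR (x g).
  rewrite (bigID (mem bad)) /= -[leLHS]addr0 lerD //; last first.
    by apply: sumr_ge0 => g _; apply: expR_ge0.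
  rewrite mulr_natl -sumr_const; apply: ler_sum => g; rewrite inE => gbad.
  rewrite ler_expR /x ler_wnM2l //; first by rewrite mulNr oppr_le0 mulr_ge0 ?ler0n.
  by rewrite ler_pdivrMr ?ltr0n // ltW.
have := le_trans markov mass.
rewrite -ler_pdivlMr ?expR_gt0 // -expRN mulrAC -expRD => /le_trans; apply.
rewrite ler_wpM2r ?ler0n // ler_expR.
have -> : - th * beta * b%:R - - lam * b%:R * (beta - eta) =
   ((lam - th) * beta - lam * eta) * b%:R by ring.
rewrite ler_wpM2r ?ler0n //.
have := expRN_quadratic lam0; have := expR_ge1Dx (- lam).
rewrite /th /lam; set u := expR _ => u1 u2.
nra.
Qed.

(** * Links and pullbacks *)

Lemma uniform_sieve (k : nat) (V : finType) (P : pred {set V}) :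
  [forall e in [set e : {set V} | (#|e| == k) && P e]%SET, #|e| == k].
Proof. by apply/forall_inP => e; rewrite inE => /andP[]. Qed.

Definition kgraph_of (k : nat) (V : finType) (P : pred {set V}) : kgraph k V :=
  KGraph (uniform_sieve k P).

Lemma edges_kgraph_of (k : nat) (V : finType) (P : pred {set V}) (e : {set V}) :
  (e \in edges (kgraph_of k P)) = (#|e| == k) && P e.
Proof. by rewrite inE. Qed.

Lemma card_edge (k : nat) (V : finType) (H : kgraph k V) (e : {set V}) :
  e \in edges H -> #|e| = k.
Proof. by move=> eH; apply/eqP; move/forall_inP: (edges_uniform H); apply. Qed.

Definition pullback (k : nat) (V W : finType) (g : {ffun V -> W}) (H : kgraph k W) :
    kgraph k V :=
  kgraph_of k (fun e => g @: e \in edges H).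

Definition link_tuples (k d : nat) (V : finType) (H : kgraph k V) (S : {set V}) :
    {set {ffun 'I_d -> V}} :=
  [set a : {ffun 'I_d -> V} | S :|: [set a j | j in 'I_d] \in edges H]%SET.

(** Working with ordered tuples turns degrees into densities in a power of the vertex
set, at the cost of the factor d!. *)
Lemma card_link_tuples (l d : nat) (V : finType) (H : kgraph (l + d) V) (S : {set V}) :
  #|S| = l -> #|link_tuples d H S| = (d`! * degree H S)%N.
Proof.
move=> Sl; rewrite -sum1_card.
rewrite (partition_big (fun a : {ffun 'I_d -> V} => S :|: [set a j | j in 'I_d])%SET
  (mem [set e in edges H | S \subset e]%SET)) /=; last first.
  by move=> a; rewrite !inE => ->; rewrite finset.subsetUl.
rewrite mulnC /degree -sum_nat_const; apply: eq_bigr => e; rewrite inE => /andP[eH Se].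
have eSd : #|e :\: S| = d by rewrite cardsDS // (card_edge eH) Sl addKn.
rewrite sum1dep_card -[RHS]ffactnn.
transitivity (#|e :\: S| ^_ #|'I_d|)%N; last by rewrite eSd card_ord.
rewrite -card_inj_ffuns_on; apply: eq_card => a; rewrite !inE.
apply/andP/andP => [[_ /eqP ae]|[/ffun_onP aeS /injectiveP ainj]].
  have le_d : (#|[set a j | j in 'I_d]%SET| <= d)%N.
    by rewrite -[X in (_ <= X)%N]card_ord leq_imset_card.
  have := cardsUI S [set a j | j in 'I_d]%SET; rewrite ae (card_edge eH) Sl => cU.
  have I0 : #|S :&: [set a j | j in 'I_d]|%SET = 0%N by lia.
  have aSj j : a j \notin S.
    apply/negP => ajS; move/eqP: I0; rewrite cards_eq0 => /eqP/setP/(_ (a j)).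
    by rewrite !inE ajS imset_f.
  split.
    apply/ffun_onP => j; rewrite inE aSj -ae inE imset_f ?orbT //.
  have /imset_injP ainj : #|[set a j | j in 'I_d]%SET| == #|'I_d| by rewrite card_ord; lia.
  by apply/injectiveP => i j; apply: ainj.
have aE : [set a j | j in 'I_d]%SET = e :\: S.
  apply/eqP; rewrite eqEcard eSd card_imset // card_ord leqnn andbT.
  by apply/fintype.subsetP => x /imsetP[j _ ->].
have SE : (S :|: e :\: S = e)%SET by rewrite -{1}(finset.setIidPr Se) finset.setID.
by rewrite aE SE eH.
Qed.

(** A tuple outside S that hits the link of the image of S is an ordering of an edge of
the pullback containing S; the relevant tuples are automatically disjoint from S. *)
Lemma hits_le_degree (l d : nat) (T V : finType) (H : kgraph (l + d) V)
    (g : {ffun T -> V}) (S : {set T}) :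
  #|S| = l ->
  (hits (link_tuples d H (g @: S)) (pull (val : {x | x \notin S} -> T) g) <=
   d`! * degree (pullback g H) S)%N.
Proof.
move=> Sl; rewrite -card_link_tuples //.
pose lift_tuple (h : {ffun 'I_d -> {x | x \notin S}}) := [ffun j => val (h j)].
have lift_inj : injective lift_tuple.
  by move=> h h' /ffunP hh; apply/ffunP => j; have := hh j; rewrite !ffunE => /val_inj.
rewrite /hits -(card_imset _ lift_inj); apply/subset_leq_card/fintype.subsetP => a.
case/imsetP => h; rewrite !inE => /andP[/injectiveP hinj edge] ->.
have imE : [set lift_tuple h j | j in 'I_d]%SET = [set val (h j) | j in 'I_d]%SET.
  by apply: eq_imset => j; rewrite ffunE.
rewrite imE imsetU.
have -> : (g @: [set val (h j) | j in 'I_d] = [set pull h (pull val g) j | j in 'I_d])%SET.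
  by rewrite -imset_comp; apply: eq_imset => j; rewrite /= !ffunE.
rewrite edge andbT cardsU Sl card_imset ?card_ord; last first.
  by move=> i j /val_inj/hinj.
have -> : (S :&: [set val (h j) | j in 'I_d] = finset.set0)%SET.
  apply/setP => x; rewrite !inE; apply/negP => /andP[xS /imsetP[j _ xh]].
  by have := valP (h j); rewrite -xh xS.
by rewrite cards0 subn0.
Qed.

(** Conditionally on the restriction of g to S, the values of g outside S are
independent and uniform, and [hits_tail] applies to the link of the image of S. *)
Lemma bad_maps (R : realType) (l d b : nat) (T V : finType) (H : kgraph (l + d) V)
    (S : {set T}) (beta eta : R) :
  #|S| = l -> (b * d <= #|T| - l)%N -> 0 < eta -> beta <= 1 ->
  (forall S' : {set V}, #|S'| = l ->
     beta * (#|V| ^ d)%:R <= d`!%:R * (degree H S')%:R) ->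
  #|[set g : {ffun T -> V} | (#|g @: S| == l) &&
      ((degree (pullback g H) S)%:R < (beta - eta) * 'C(#|T| - l, d)%:R)]%SET|%:R <=
  expR (- (eta ^+ 2 / 4) * b%:R) * (#|V| ^ #|T|)%:R.
Proof.
move=> Sl bd eta0 beta1 dense; set bad := [set g | _]%SET.
pose W := {x | x \notin S}; pose U := {x | x \in S}.
have cW : #|{: W}| = (#|T| - l)%N 
  by rewrite card_sig -(cardsC S) Sl addKn; apply: eq_card => x; rewrite !inE.
have cU : #|{: U}| = l by rewrite card_sig.
have lT : (l <= #|T|)%N by rewrite -Sl max_card.
pose toU := pull (val : U -> T) : {ffun T -> V} -> _.
pose toW := pull (val : W -> T) : {ffun T -> V} -> _.
set t := expR _.
have fibre (u : {ffun U -> V}) :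
    #|[set g in bad | toU g == u]%SET|%:R <= t * (#|V| ^ (#|T| - l))%:R.
  have [->|[g0]] := set_0Vmem [set g in bad | toU g == u]%SET.
    by rewrite cards0 mulr_ge0 ?expR_ge0.
  rewrite !inE => /andP[/andP[/eqP g0S _] /eqP g0u].
  (* The image of S, hence the link, depends on the restriction u only. *)
  have imS g : toU g = u -> g @: S = g0 @: S.
    move=> gu; apply: eq_in_imset => x xS.
    have /ffunP /(_ (exist _ x xS : U)) := etrans gu (esym g0u).
    by rewrite !ffunE.
  have := @hits_tail R W V d b (link_tuples d H (g0 @: S)) beta eta.
  rewrite cW => /(_ bd eta0 beta1) tail.
  apply: le_trans (tail _); last first.
    by rewrite card_link_tuples // natrM; apply: dense.
  rewrite ler_nat.
  have toW_inj : {in [set g in bad | toU g == u]%SET &, injective toW}.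
    move=> g g'; rewrite !inE => /andP[_ /eqP gu] /andP[_ /eqP g'u] gg'.
    apply/ffunP => x; case: (boolP (x \in S)) => xS.
      have /ffunP /(_ (exist _ x xS : U)) := etrans gu (esym g'u).
      by rewrite !ffunE.
    by have /ffunP /(_ (exist _ x xS : W)) := gg'; rewrite !ffunE.
  rewrite -(card_in_imset toW_inj); apply/subset_leq_card/fintype.subsetP => w.
  case/imsetP => g; rewrite !inE => /andP[/andP[_ gbad] /eqP gu] ->.
  have := hits_le_degree H g Sl; rewrite (imS g gu) -(ler_nat R) => /le_lt_trans; apply.
  rewrite card_inj_ffuns card_ord cW -bin_ffact !natrM mulrA [ltRHS]mulrC.
  by rewrite ltr_pM2l ?ltr0n ?fact_gt0.
have -> : (#|V| ^ #|T| = #|V| ^ (#|T| - l) * #|{: {ffun U -> V}}|)%N.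
  by rewrite card_ffun cU -expnD subnK.
rewrite natrM mulrA mulr_natr -[leRHS]sumr_const.
apply: le_trans (_ : _ <= \sum_(u : {ffun U -> V})
   #|[set g in bad | toU g == u]%SET|%:R) _; last first.
    by apply: ler_sum => u _; apply: fibre.
rewrite -natr_sum ler_nat; apply: union_bound => g gbad.
by exists (toU g) => //; rewrite inE gbad /=.
Qed.

Lemma ffact_le_expn (n m j : nat) : (m <= n)%N -> (m ^_ j <= n ^ j)%N.
Proof.
move=> mn; elim: j => [|j IH]; first by rewrite ffactn0.
by rewrite ffactnSr expnS mulnC leq_mul // (leq_trans (leq_subr _ _)).
Qed.

(** A form without division of the fact that (n - l)(n - l - 1)...(n - l - j + 1) is
n^j up to an error of relative order 1/n. *)
Lemma expn_le_ffact (l j n : nat) :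
  (n ^ j.+1 <= n * (n - l) ^_ j + j * (l + j) * n ^ j)%N.
Proof.
elim: j => [|j IH]; first by rewrite ffactn0 expn0 expn1; lia.
rewrite ffactnSr -subnDA.
have le_nj : ((n - l) ^_ j <= n ^ j)%N by apply: ffact_le_expn; apply: leq_subr.
rewrite (expnS n j.+1); set a := ((n - l) ^_ j)%N in IH le_nj *.
have h : (a * n <= a * (n - (l + j)) + a * (l + j))%N by rewrite -mulnDr leq_mul2l; lia.
have e1 : (n ^ j.+1 = n * n ^ j)%N by rewrite expnS.
rewrite e1 in IH *; set p := (n ^ j)%N in IH le_nj *.
nia.
Qed.

(** * Sampling *)

(** The factor 4 and the power m^l leave room for the union bound over all l-subsets of
a sample of size m. *)
Lemma expR_beats_power (R : realType) (c : R) (l : nat) : 0 < c ->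
  exists m0 : nat, forall m : nat, (m0 <= m)%N -> 4 * m%:R ^+ l <= expR (c * m%:R).
Proof.
move=> c0; pose a := c / l.+1%:R.
have a0 : 0 < a by rewrite divr_gt0 ?ltr0n.
exists (Num.trunc (4 / a ^+ l.+1)).+1 => m mbig.
have mb : 4 / a ^+ l.+1 <= m%:R.
  apply: le_trans (ltW (truncnS_gt _)) _; by rewrite ler_nat.
have -> : expR (c * m%:R) = expR (a * m%:R) ^+ l.+1.
  by rewrite -expRM_natr /a mulrAC divfK ?pnatr_eq0.
apply: le_trans (_ : (a * m%:R) ^+ l.+1 <= _); last first.
  apply: lerXn2r; rewrite ?nnegrE ?expR_ge0 ?(mulr_ge0 (ltW a0)) ?ler0n //.
  by apply: le_trans (expR_ge1Dx _); rewrite lerDr.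
rewrite exprMn [m%:R ^+ l.+1]exprS mulrA ler_wpM2r ?exprn_ge0 ?ler0n //.
by move: mb; rewrite ler_pdivrMr ?exprn_gt0 // mulrC.
Qed.

Lemma link_density (R : realType) (l d n : nat) (alpha eta : R) :
  (0 < n)%N -> 0 < eta -> alpha <= 1 -> (d * (l + d))%:R <= eta * n%:R ->
  (alpha - eta) * (n ^ d)%:R <= alpha * (d`! * 'C(n - l, d))%:R.
Proof.
move=> n0 eta0 alpha1 nbig.
rewrite (mulnC d`!) bin_ffact.
have := expn_le_ffact l d n; rewrite -(ler_nat R) natrD !natrM expnS natrM => key.
have n0' : 0 < n%:R :> R by rewrite ltr0n.
have p0 : 0 <= (n ^ d)%:R :> R by rewrite ler0n.
have lower : (n ^ d)%:R <= ((n - l) ^_ d)%:R + eta * (n ^ d)%:R :> R.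
  rewrite -(ler_pM2l n0'); apply: le_trans key _; rewrite mulrDr lerD2l.
  by rewrite mulrA ler_wpM2r // [leRHS]mulrC -natrM.
have upper : ((n - l) ^_ d)%:R <= (n ^ d)%:R :> R.
  by rewrite ler_nat ffact_le_expn // leq_subr.
nra.
Qed.

Lemma card_non_injective (m : nat) (V : finType) :
  (4 * m ^ 2 <= #|V|)%N ->
  (4 * #|[set g : {ffun 'I_m -> V} | ~~ injectiveb g]%SET| <= #|V| ^ m)%N.
Proof.
move=> big; have [->|m0] := posnP m.
  rewrite (_ : [set g | _]%SET = finset.set0) ?cards0 //.
  apply/setP => g; rewrite !inE; apply/negbTE; rewrite negbK.
  by apply/injectiveP => -[].
have V0 : (0 < #|V|)%N by apply: leq_trans big; rewrite muln_gt0 expn_gt0 m0.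
have := cardsC [set g : {ffun 'I_m -> V} | injectiveb g]%SET.
rewrite card_inj_ffuns card_ffun card_ord => total.
have -> : [set g : {ffun 'I_m -> V} | ~~ injectiveb g]%SET =
   (~: [set g : {ffun 'I_m -> V} | injectiveb g])%SET by apply/setP => g; rewrite !inE.
have := expn_le_ffact 0 m #|V|; rewrite subn0 add0n expnS => key.
rewrite -(leq_pmul2l V0).
set N := (#|V| ^ m)%N in total key *; set I := (#|V| ^_ m)%N in total key *.
set X := #|_| in total *.
have h : (4 * (m * m * N) <= #|V| * N)%N.
  by rewrite mulnA leq_mul2r (_ : 4 * (m * m) = 4 * m ^ 2)%N ?big ?orbT // expnS expn1.
nia.
Qed.

(** The pullback along an injective map is the subhypergraph induced on the sample. *)
Definition good_map (R : realType) (l d m : nat) (V : finType) (H : kgraph (l + d) V)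
    (alpha : R) (g : {ffun 'I_m -> V}) : bool :=
  injectiveb g &&
  [forall (S : {set 'I_m} | #|S| == l),
     alpha * 'C(m - l, d)%:R <= (degree (pullback g H) S)%:R].

(** The proportion of maps that are not injective is at most m^2/n, and there are at
most m^l sets S, each of which is bad for an exponentially small proportion of the
maps. *)
Lemma sampling (R : realType) (l d : nat) (eta : R) : (0 < d)%N -> 0 < eta ->
  exists m0 : nat, forall m : nat, (m0 <= m)%N ->
  exists n0 : nat, forall V : finType, (n0 <= #|V|)%N ->
  forall (H : kgraph (l + d) V) (alpha : R), alpha <= 1 ->
  (forall S : {set V}, #|S| = l ->
     alpha * 'C(#|V| - l, d)%:R <= (degree H S)%:R) ->
  (#|V| ^ m <= 2 * #|[set g | @good_map R l d m V H (alpha - eta) g]%SET|)%N.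
Proof.
move=> d0 eta0; pose e := eta / 2.
have e0 : 0 < e by rewrite /e; lra.
have c0 : 0 < e ^+ 2 / 4 / (2 * d)%:R.
  by rewrite !divr_gt0 ?exprn_gt0 ?ltr0n ?muln_gt0.
have [m1 m1P] := expR_beats_power l c0.
(* With m >= 2(l + d), the b disjoint blocks of size d outside S satisfy 2db >= m. *)
exists (maxn m1 (2 * (l + d))) => m; rewrite geq_max => /andP[/m1P expbig mbig].
exists (maxn (4 * m ^ 2) (Num.trunc ((d * (l + d))%:R / e)).+1) => V.
rewrite geq_max => /andP[Vm Ve] H alpha alpha1 degH.
have V0 : (0 < #|V|)%N by apply: leq_trans Ve.
have Ve' : (d * (l + d))%:R <= e * #|V|%:R.
  rewrite mulrC -ler_pdivrMr //; apply: le_trans (ltW (truncnS_gt _)) _.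
  by rewrite ler_nat.
pose b := ((m - l) %/ d)%N.
have bd : (b * d <= m - l)%N by apply: leq_trunc_div.
have bm : (m <= 2 * d * b)%N.
  have := divn_eq (m - l) d; have := ltn_pmod (m - l) d0; rewrite -/b; nia.
pose bad (S : {set 'I_m}) := [set g : {ffun 'I_m -> V} | (#|g @: S| == l) &&
      ((degree (pullback g H) S)%:R < (alpha - e - e) * 'C(m - l, d)%:R)]%SET.
have bad_le (S : {set 'I_m}) : #|S| = l ->
    #|bad S|%:R <= expR (- (e ^+ 2 / 4) * b%:R) * (#|V| ^ m)%:R.
  move=> Sl; have := @bad_maps R l d b 'I_m V H S (alpha - e) e Sl.
  rewrite card_ord; apply=> //; first lra.
  move=> S' S'l; apply: le_trans (link_density V0 e0 alpha1 Ve') _.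
  by rewrite natrM mulrCA ler_wpM2l ?ler0n ?degH.
have sum_bad : (4 * \sum_(S : {set 'I_m} | #|S| == l) #|bad S| <= #|V| ^ m)%N.
  rewrite -(ler_nat R) natrM natr_sum.
  apply: le_trans (_ : 4 * (\sum_(S : {set 'I_m} | #|S| == l)
      (expR (- (e ^+ 2 / 4) * b%:R) * (#|V| ^ m)%:R)) <= _).
    by rewrite ler_wpM2l ?ler0n // ler_sum // => S /eqP; apply: bad_le.
  have cardS : #|[set S : {set 'I_m} | #|S| == l]%SET| = 'C(m, l) by rewrite card_draws card_ord.
  set t := expR _ * _; have -> : \sum_(S : {set 'I_m} | #|S| == l) t = 'C(m, l)%:R * t.
    by rewrite -cardS mulr_natl -sumr_const; apply: eq_bigl => S; rewrite inE.
  rewrite /t !mulrA -[leRHS]mul1r ler_wpM2r ?ler0n //.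
  rewrite mulNr expRN ler_pdivrMr ?expR_gt0 // mul1r.
  apply: le_trans (_ : 4 * m%:R ^+ l <= _).
    rewrite ler_wpM2l // -natrX ler_nat.
    by rewrite (leq_trans _ (ffact_le_expn l (leqnn m))) // -bin_ffact leq_pmulr ?fact_gt0.
  apply: le_trans expbig _; rewrite ler_expR -mulrA ler_wpM2l //.
    by rewrite divr_ge0 ?exprn_ge0 ?ltW.
  by rewrite mulrC ler_pdivrMr ?ltr0n ?muln_gt0 // -natrM ler_nat mulnC.
set good := [set g | _]%SET.
have cover : (#|~: good|%SET <= #|[set g : {ffun 'I_m -> V} | ~~ injectiveb g]%SET| +
    \sum_(S : {set 'I_m} | #|S| == l) #|bad S|)%N.
  rewrite -leq_subLR; set NI := [set g | _]%SET.
  apply: leq_trans (_ : #|~: good :\: NI|%SET <= _)%N.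
    by rewrite leq_subLR -{1}(finset.setID (~: good)%SET NI) (leq_trans (leq_card_setU _ _)) //
       leq_add2r subset_leq_card // finset.subsetIr.
  apply: union_bound => g; rewrite !inE negbK => /andP[ginj].
  rewrite /good_map ginj /= => /forall_inPn[S /eqP Sl]; rewrite -ltNge => Sbad.
  exists S; first by rewrite Sl.
  rewrite inE card_imset ?Sl ?eqxx /=; last exact/injectiveP.
  by rewrite (_ : alpha - e - e = alpha - eta) // /e; field.
have := card_non_injective Vm; have := cardsC good; rewrite card_ffun card_ord.
lia.
Qed.

(** * Existence of the limit *)

Lemma degree_le_edges (k : nat) (V : finType) (H : kgraph k V) (S : {set V}) :
  (degree H S <= #|edges H|)%N.
Proof. by apply/subset_leq_card/fintype.subsetP => e; rewrite inE => /andP[]. Qed.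

Lemma min_degree_le (l k : nat) (V : finType) (H : kgraph k V) (S : {set V}) :
  #|S| = l -> (min_degree l H <= degree H S)%N.
Proof.
move=> /eqP Sl; rewrite /min_degree.
have : S \in index_enum {set V} by rewrite mem_index_enum.
elim: (index_enum _) => // T r IH; rewrite inE big_cons => /predU1P[<-|/IH{}IH].
  by rewrite Sl geq_minl.
by case: ifP => // _; rewrite geq_min IH orbT.
Qed.

(** The neutral element of the minimum bounds every degree, so that it is not attained
unless it is itself a degree. *)
Lemma min_degree_attained (l k : nat) (V : finType) (H : kgraph k V) :
  (l <= #|V|)%N -> exists2 S : {set V}, #|S| = l & min_degree l H = degree H S.
Proof.
rewrite -cardsT => /subset_of_card[S0 _ S0l].
have [|//] : min_degree l H = #|edges H| \/
    exists2 S : {set V}, #|S| = l & min_degree l H = degree H S.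
  rewrite /min_degree; elim/big_ind: _ => [|x y|S /eqP Sl]; first by left.
  - by rewrite /minn; case: ifP.
  - by right; exists S.
move=> minE; exists S0 => //; apply/eqP; rewrite eqn_leq min_degree_le //=.
by rewrite minE degree_le_edges.
Qed.

Lemma degree_le_bin (l d : nat) (V : finType) (H : kgraph (l + d) V) (S : {set V}) :
  #|S| = l -> (degree H S <= 'C(#|V| - l, d))%N.
Proof.
move=> Sl; have -> : (#|V| - l = #|~: S|%SET)%N by rewrite -(cardsC S) Sl addKn.
rewrite -cards_draws /degree.
have Dinj : {in [set e in edges H | S \subset e]%SET &, injective (fun e => e :\: S)%SET}.
  move=> e e'; rewrite !inE => /andP[_ Se] /andP[_ Se'] ee'.
  by rewrite -(finset.setID e S) -(finset.setID e' S)
     (finset.setIidPr Se) (finset.setIidPr Se') ee'.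
rewrite -(card_in_imset Dinj); apply/subset_leq_card/fintype.subsetP => D.
case/imsetP => e; rewrite inE => /andP[eH Se] ->.
rewrite inE cardsDS // (card_edge eH) Sl addKn eqxx andbT.
by rewrite finset.setDE finset.subsetIr.
Qed.

Lemma is_free_pullback (k : nat) (U V W : finType) (F : kgraph k U) (H : kgraph k W)
    (g : {ffun V -> W}) : injective g -> is_free F H -> is_free F (pullback g H).
Proof.
move=> ginj; apply: contra => /existsP[f /andP[/injectiveP finj /forall_inP fF]].
apply/existsP; exists [ffun x => g (f x)]; apply/andP; split.
  by apply/injectiveP => x y; rewrite !ffunE => /ginj/finj.
apply/forall_inP => e /fF; rewrite edges_kgraph_of => /andP[_].
have -> : ([ffun x => g (f x)] @: e = g @: (f @: e))%SET; last by [].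
by rewrite -imset_comp; apply: eq_imset => x; rewrite ffunE.
Qed.

Lemma min_degree_le_ex (l n k : nat) (U : finType) (F : kgraph k U) (H : kgraph k 'I_n) :
  is_free F H -> (min_degree l H <= ex l n F)%N.
Proof.
move=> Hfree; rewrite /ex.
exact: (@leq_bigmax_cond _ (fun G : kgraph k 'I_n => is_free F G)
  (fun G => min_degree l G) H Hfree).
Qed.

Lemma ex_attained (l n k : nat) (U : finType) (F : kgraph k U) :
  (0 < ex l n F)%N -> exists2 H : kgraph k 'I_n, is_free F H & min_degree l H = ex l n F.
Proof.
move=> ex_gt0; case: (pickP (fun H : kgraph k 'I_n => is_free F H)) => [H0 H0free|none].
  have c0 : (0 < #|[pred H : kgraph k 'I_n | is_free F H]|)%N.
    by apply/card_gt0P; exists H0.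
  have [H Hfree HE] := eq_bigmax_cond (fun H : kgraph k 'I_n => min_degree l H) c0.
  by exists H; rewrite // -HE.
by move: ex_gt0; rewrite /ex big_pred0.
Qed.

Lemma ex_ratio_ge0 (R : realType) (l k n : nat) (U : finType) (F : kgraph k U) :
  0 <= ex_ratio R l F n.
Proof. by rewrite divr_ge0 ?ler0n. Qed.

Lemma ex_ratio_le1 (R : realType) (l d n : nat) (U : finType) (F : kgraph (l + d) U) :
  (l + d <= n)%N -> ex_ratio R l F n <= 1.
Proof.
move=> ldn; rewrite /ex_ratio addKn ler_pdivrMr ?ltr0n ?bin_gt0; last by lia.
rewrite mul1r ler_nat; apply/bigmax_leqP => H _.
have [|S Sl ->] := @min_degree_attained l _ _ H; first by rewrite card_ord; lia.
by rewrite -[n in 'C(n - l, d)%N]card_ord degree_le_bin.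
Qed.

(** An induced subhypergraph of an F-free hypergraph is F-free, so that a sample
competes in the definition of the extremal number on m vertices. *)
Lemma ex_ratio_almost_nonincreasing (R : realType) (l d : nat) (U : finType)
    (F : kgraph (l + d) U) (eta : R) : (0 < d)%N -> 0 < eta ->
  exists m0 : nat, forall m : nat, (m0 <= m)%N ->
  exists n0 : nat, forall n : nat, (n0 <= n)%N ->
  ex_ratio R l F n <= ex_ratio R l F m + eta.
Proof.
move=> d0 eta0; have [m1 m1P] := @sampling R l d eta d0 eta0.
exists (maxn m1 (l + d)) => m; rewrite geq_max => /andP[/m1P[n1 n1P] ldm].
exists (maxn n1 (l + d)) => n; rewrite geq_max => /andP[n1n ldn].
have [ex0|] := posnP (ex l n F).
  by rewrite {1}/ex_ratio ex0 mul0r addr_ge0 ?ex_ratio_ge0 ?ltW.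
case/ex_attained => H Hfree Hdeg.
have Cn : 0 < 'C(n - l, d)%:R :> R by rewrite ltr0n bin_gt0; lia.
have Cm : 0 < 'C(m - l, d)%:R :> R by rewrite ltr0n bin_gt0; lia.
have degH (S : {set 'I_n}) : #|S| = l ->
    ex_ratio R l F n * 'C(#|'I_n| - l, d)%:R <= (degree H S)%:R.
  move=> Sl; rewrite card_ord /ex_ratio addKn divfK ?gt_eqF // ler_nat -Hdeg.
  exact: min_degree_le.
have := n1P 'I_n; rewrite card_ord => /(_ n1n H _ (ex_ratio_le1 R F ldn)).
rewrite card_ord in degH; move=> /(_ degH) count.
have nm : (0 < n ^ m)%N by rewrite expn_gt0; apply/orP; left; lia.
have /card_gt0P[g] : (0 < #|[set g : {ffun 'I_m -> 'I_n} |
    good_map H (ex_ratio R l F n - eta) g]%SET|)%N.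
  by have := leq_trans nm count; rewrite muln_gt0.
rewrite inE => /andP[/injectiveP ginj /forall_inP gdeg].
have [|S Sl minE] := @min_degree_attained l _ _ (pullback g H).
  by rewrite card_ord; lia.
rewrite -lerBlDr [leRHS]/ex_ratio addKn ler_pdivlMr //.
apply: le_trans (gdeg S _) _; first exact/eqP.
by rewrite -minE ler_nat min_degree_le_ex // is_free_pullback.
Qed.

(** The limit is the upper limit, written as the supremum of the numbers that the
sequence exceeds infinitely often: almost monotonicity makes every late term nearly
as large as later ones. *)
Lemma cvgn_almost_nonincreasing (R : realType) (u : R^nat) (M : R) (N0 : nat) :
  (forall n, 0 <= u n) -> (forall n, (N0 <= n)%N -> u n <= M) ->
  (forall eta : R, 0 < eta -> exists m0 : nat, forall m : nat, (m0 <= m)%N ->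
     exists n0 : nat, forall n : nat, (n0 <= n)%N -> u n <= u m + eta) ->
  cvgn u.
Proof.
move=> u0 uM almost.
pose E := [set x : R | forall N : nat, exists n : nat, (N <= n)%N /\ x <= u n]%classic.
have supE : has_sup E.
  split; first by exists 0 => N; exists N.
  by exists M => x /(_ N0)[n [N0n xu]]; apply: le_trans xu (uM n N0n).
apply/cvg_ex; exists (sup E); apply/cvgrPdist_le => e e0.
have [y Ey ylt] := sup_adherent (divr_gt0 e0 (ltr0n R 2)) supE.
have [m0 m0P] := almost _ (divr_gt0 e0 (ltr0n R 2)).
have [N1 N1P] : exists N1 : nat, forall n : nat, (N1 <= n)%N -> u n < sup E + e.
  apply: contrapT => noN.
  have : E (sup E + e).
    move=> N; apply: contrapT => non; apply: noN; exists N => n Nn.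
    by rewrite ltNge; apply/negP => un; apply: non; exists n.
  move=> /(ub_le_sup (proj2 supE)); lra.
exists (maxn m0 N1) => // m /=; rewrite geq_max => /andP[/m0P[n0 n0P] /N1P um].
have [n [n0n yn]] := Ey n0; have := n0P n n0n.
by move=> unm; rewrite ler_norml; apply/andP; split; lra.
Qed.

Lemma ex_ratio_cvg (R : realType) (l d : nat) (U : finType) (F : kgraph (l + d) U) :
  (0 < d)%N -> cvgn (ex_ratio R l F).
Proof.
move=> d0; apply: (@cvgn_almost_nonincreasing R _ 1 (l + d)).
- by move=> n; apply: ex_ratio_ge0.
- by move=> n; apply: ex_ratio_le1.
- by move=> eta; apply: ex_ratio_almost_nonincreasing.
Qed.

(** * Cyclic colour patterns *)

Definition mult (V : finType) (col : V -> nat) (e : {set V}) (x : nat) : nat :=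
  #|[set v in e | col v == x]%SET|.

(** The condition on the colour 0 serves only to produce a first monochromatic l-set;
see [recurrent_colours]. *)
Definition admissible (N l : nat) (V : finType) (col : V -> nat) (e : {set V}) : bool :=
  [forall x : 'I_N, (l <= mult col e x)%N ==> (0 < mult col e (x.+1 %% N))%N] &&
  ([exists x : 'I_N, (l <= mult col e x)%N] || (0 < mult col e 0)%N).

Lemma mult_gt0P (V : finType) (col : V -> nat) (e : {set V}) (x : nat) :
  reflect (exists2 v, v \in e & col v = x) (0 < mult col e x)%N.
Proof.
apply: (iffP card_gt0P) => [[v]|[v ve vx]].
  by rewrite inE => /andP[ve /eqP vx]; exists v.
by exists v; rewrite inE ve vx eqxx.
Qed.

(** Adding vertices of pairwise distinct new colours creates no new repeated colour. *)
Lemma mult_setU_fresh (V : finType) (d : nat) (col : V -> nat) (S : {set V})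
    (v : 'I_d -> V) (x : nat) :
  (forall j w, w \in S -> col w != col (v j)) -> injective (fun j => col (v j)) ->
  (mult col (S :|: [set v j | j in 'I_d])%SET x <= maxn 1 (mult col S x))%N.
Proof.
move=> fresh cinj; have [/mult_gt0P[w wS wx]|] := boolP (0 < mult col S x)%N.
  rewrite leq_max; apply/orP; right; apply/subset_leq_card/fintype.subsetP => u.
  rewrite !inE => /andP[/orP[->//|/imsetP[j _ ->] /eqP jx]].
  by have := fresh j w wS; rewrite wx jx eqxx.
move=> Sx; rewrite leq_max; apply/orP; left; apply/card_le1_eqP => u u'.
have inv y : y \in [set w in (S :|: [set v j | j in 'I_d]) | col w == x]%SET ->
    exists2 j, y = v j & col (v j) = x.
  rewrite !inE => /andP[/orP[yS /eqP yx|/imsetP[j _ ->] /eqP jx]]; last by exists j.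
  by case/negP: Sx; apply/mult_gt0P; exists y.
by move=> /inv[j -> jx] /inv[j' -> j'x]; congr v; apply: cinj; rewrite jx.
Qed.

(** For S monochromatic of colour x, take x+1, ..., x+d.  Otherwise take distinct
colours that do not occur on S, beginning with 0 if 0 is one of them.  As l >= 2, the
added vertices create no further l-fold colour. *)
Lemma extension_colours (N l d : nat) (V : finType) (col : V -> nat) (S : {set V}) :
  (1 < l)%N -> (0 < d)%N -> (l + d <= N)%N -> #|S| = l -> (forall v, col v < N)%N ->
  exists c : 'I_d -> nat, [/\ injective c, forall j, (c j < N)%N,
    forall j w, w \in S -> col w != c j &
    forall v : 'I_d -> V, (forall j, col (v j) = c j) ->
      admissible N l col (S :|: [set v j | j in 'I_d])%SET].
Proof.
move=> l1 d0 ldN Sl colN.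
have N0 : (0 < N)%N by lia.
have mult_le x : (mult col S x <= l)%N.
  by rewrite -Sl; apply/subset_leq_card/fintype.subsetP => v; rewrite inE => /andP[].
have multU v x : (mult col S x <= mult col (S :|: [set v j | j in 'I_d])%SET x)%N.
  by apply/subset_leq_card/fintype.subsetP => w; rewrite !inE => /andP[->].
case: (boolP [exists x : 'I_N, mult col S x == l]) => [/existsP[x /eqP Sx]|/existsPn nomono].
  have mono w : w \in S -> col w = x.
    have SE : [set w in S | col w == x]%SET = S.
      apply/eqP; rewrite eqEcard [#|[set w in S | _]%SET|]Sx Sl leqnn andbT.
      by apply/fintype.subsetP => y; rewrite inE => /andP[].
    by rewrite -SE inE => /andP[_ /eqP].
  have xN := ltn_ord x.
  pose c (j : 'I_d) := ((x + j.+1) %% N)%N.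
  have cE (j : 'I_d) : c j = (if x + j.+1 < N then x + j.+1 else x + j.+1 - N)%N.
    have jd := ltn_ord j; rewrite /c; case: ltnP => h; first by rewrite modn_small.
    by rewrite -{1}(subnK h) modnDr modn_small //; lia.
  have cinj : injective c.
    move=> i j; rewrite !cE => h; apply/val_inj => /=.
    have := ltn_ord i; have := ltn_ord j; move: h; do 2 case: ifP => ?; lia.
  have cx j : (x : nat) != c j.
    by rewrite cE; have := ltn_ord j; case: ifP => ? ?; lia.
  exists c; split=> // [j|j w /mono ->//|v vc]; first by rewrite ltn_mod.
  have fresh j w : w \in S -> col w != col (v j) by rewrite vc => /mono ->.
  have vinj : injective (fun j => col (v j)) by move=> i j; rewrite !vc => /cinj.
  apply/andP; split; last first.
    by apply/orP; left; apply/existsP; exists x; apply: leq_trans (multU v x); rewrite Sx.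
  apply/forallP => y; apply/implyP => ly; apply/mult_gt0P.
  have yx : y = x.
    have := leq_trans ly (mult_setU_fresh y fresh vinj).
    rewrite leq_max leqNgt l1 /= => lS.
    have /mult_gt0P[w /mono wx wy] : (0 < mult col S y)%N by apply: leq_trans lS; lia.
    by apply: val_inj; rewrite /= -wy wx.
  exists (v (Ordinal d0)); first by rewrite inE imset_f ?orbT.
  by rewrite vc /c yx addn1.
pose U := [seq x <- iota 0 N | x \notin map col (enum S)].
have Usize : (d <= size U)%N.
  have := count_predC [in map col (enum S)] (iota 0 N); rewrite size_iota.
  have : (size [seq x <- iota 0 N | x \in map col (enum S)] <= size (map col (enum S)))%N.
    apply: uniq_leq_size; first by rewrite filter_uniq ?iota_uniq.
    by move=> y; rewrite mem_filter => /andP[].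
  rewrite size_map -cardE Sl !size_filter; set A := count _ _; set B := count _ _.
  by move=> ? ?; have -> : B = count [predC map col (enum S)] (iota 0 N) by []; lia.
pose c (j : 'I_d) := nth 0 U j.
have cU j : c j \in U by apply/mem_nth/(leq_trans _ Usize).
have cinj : injective c.
  move=> i j /eqP; rewrite nth_uniq ?filter_uniq ?iota_uniq //.
  - by move=> /eqP /val_inj.
  - exact: leq_trans Usize.
  - exact: leq_trans Usize.
have cfresh j w : w \in S -> col w != c j.
  move=> wS; apply: contraTneq (cU j) => <-; rewrite mem_filter negb_and negbK.
  by rewrite map_f ?mem_enum.
exists c; split=> // [j|v vc].
  by have := cU j; rewrite mem_filter mem_iota => /andP[_ /andP[]].
have fresh j w : w \in S -> col w != col (v j) by rewrite vc => /cfresh.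
have vinj : injective (fun j => col (v j)) by move=> i j; rewrite !vc => /cinj.
apply/andP; split.
  apply/forallP => y; apply/implyP => ly.
  have := leq_trans ly (mult_setU_fresh y fresh vinj).
  rewrite leq_max leqNgt l1 /= => lS.
  by have := nomono y; rewrite eqn_leq mult_le lS.
apply/orP; right; apply/mult_gt0P.
have [/mapP[w wS w0]|S0] := boolP (0 \in map col (enum S)).
  by exists w; rewrite // inE -mem_enum wS.
exists (v (Ordinal d0)); first by rewrite inE imset_f ?orbT.
by rewrite vc /c /U; case: (N) N0 => // M _; rewrite /= S0.
Qed.

Definition pattern_graph (N l k n : nat) : kgraph k 'I_n :=
  kgraph_of k (admissible N l (fun v : 'I_n => v %% N)%N).

(** Each of the d colours supplied by [extension_colours] has at least n/N vertices,
and the colours reveal which vertex of the edge was chosen in which class. *)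
Lemma pattern_degree (N l d n : nat) (S : {set 'I_n}) :
  (1 < l)%N -> (0 < d)%N -> (l + d <= N)%N -> #|S| = l ->
  ((n %/ N) ^ d <= degree (pattern_graph N l (l + d) n) S)%N.
Proof.
move=> l1 d0 ldN Sl; have N0 : (0 < N)%N by lia.
have [v|c [cinj cN cS cadm]] :=
    @extension_colours N l d 'I_n (fun v => v %% N)%N S l1 d0 ldN Sl.
  by rewrite ltn_mod.
have lt_n (j : 'I_d) (i : 'I_(n %/ N)) : (c j + N * i < n)%N.
  have := cN j; have := ltn_ord i; have := leq_trunc_div n N; nia.
pose v (a : {ffun 'I_d -> 'I_(n %/ N)}) (j : 'I_d) : 'I_n := Ordinal (lt_n j (a j)).
have vcol a j : (v a j %% N)%N = c j by rewrite /= addnC mulnC modnMDl modn_small.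
pose e a := (S :|: [set v a j | j in 'I_d])%SET.
have einj : injective e.
  move=> a a' /setP eaa'; apply/ffunP => j.
  have := eaa' (v a j); rewrite !inE imset_f // orbT => /esym/orP[vS|/imsetP[i _ vE]].
    by have := cS j _ vS; rewrite vcol eqxx.
  have ij : i = j by apply: cinj; rewrite -(vcol a' i) -vE vcol.
  move: vE; rewrite ij => /(congr1 val) /= /eqP.
  by rewrite eqn_add2l eqn_pmul2l // => /eqP /val_inj.
rewrite -{1}(card_ord (n %/ N)) -{1}(card_ord d) -card_ffun -(card_imset _ einj).
apply/subset_leq_card/fintype.subsetP => _ /imsetP[a _ ->].
rewrite inE edges_kgraph_of finset.subsetUl andbT cadm ?andbT; last exact: vcol.
have vinj : injective (v a) by move=> i j vij; apply: cinj; rewrite -(vcol a i) vij vcol.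
rewrite cardsU Sl card_imset // card_ord (_ : S :&: _ = finset.set0)%SET ?cards0 ?subn0 //.
apply/setP => w; rewrite !inE; apply/negP => /andP[wS /imsetP[j _ wE]].
by have := cS j w wS; rewrite wE vcol eqxx.
Qed.

(** * Recurrent hypergraphs *)

(** States are injective functions rather than sets, so that they can be given
coordinatewise in a product. *)
Definition recurrent (s l d k : nat) (V : finType) (F : kgraph k V) : Prop :=
  exists P : {set {ffun 'I_s -> V}},
    [/\ P != finset.set0, forall p, p \in P -> injective p &
    forall p (S : {set 'I_s}), p \in P -> #|S| = l ->
      exists2 q : 'I_d -> {ffun 'I_s -> V}, forall j, q j \in P &
        forall a : 'I_d -> 'I_s,
          (p @: S :|: [set q j (a j) | j in 'I_d])%SET \in edges F].

(** A greedy choice: each new colour to be avoided rules out fewer than l of the s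
vertices. *)
Lemma rainbow_choice (s l d : nat) (col : 'I_d -> 'I_s -> nat) (C : seq nat) :
  (l * (size C + d) <= s)%N ->
  (0 < s)%N ->
  (forall j x, #|[set i | col j i == x]%SET| < l)%N ->
  exists2 a : 'I_d -> 'I_s, injective (fun j => col j (a j)) &
    forall j, col j (a j) \notin C.
Proof.
elim: d col C => [|d IH] col C big s0 few.
  by exists (fun=> Ordinal s0) => -[].
have [i0 i0C] : exists i0, col ord0 i0 \notin C.
  apply: contrapT => inC.
  have cover : (#|[set: 'I_s]%SET| <=
      \sum_(y < size C) #|[set i | col ord0 i == nth 0 C y]%SET|)%N.
    apply: union_bound => i _; have [iC|iC] := boolP (col ord0 i \in C); last first.
      by case: inC; exists i.
    have lt_i : (index (col ord0 i) C < size C)%N by rewrite index_mem.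
    by exists (Ordinal lt_i); rewrite // inE nth_index.
  have : (\sum_(y < size C) #|[set i | col ord0 i == nth 0 C y]%SET| <= size C * l)%N.
    rewrite -[X in (_ <= X * _)%N]card_ord -sum_nat_const leq_sum // => y _.
    exact/ltnW/few.
  move: cover; rewrite cardsT card_ord; have := few ord0 0%N; nia.
have [||a ainj aC] := IH (fun j => col (lift ord0 j)) (col ord0 i0 :: C) _ s0.
- by rewrite /= addSnnS.
- by move=> j x; apply: few.
exists (fun j => if unlift ord0 j is Some j' then a j' else i0) => [j j'|j].
  case: unliftP => [i ->|->]; case: unliftP => [i' ->|->] //.
  - by move=> /ainj ->.
  - by move=> h; have := aC i; rewrite inE h eqxx.
  - by move=> h; have := aC i'; rewrite inE h eqxx.
by case: unliftP => [i ->|-> //]; have := aC i; rewrite inE negb_or => /andP[].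
Qed.

(** If no state had l vertices of one colour, one could choose l vertices of a state
avoiding the colour 0 and complete them to an edge by vertices of new distinct
nonzero colours, against admissibility.  From a state with l vertices of colour x one
passes to a state of colour x+1 throughout, and so on around the cycle of all N
colours.  The bound on s allows the d new colours to avoid one another, the colours of
S and 0. *)
Lemma recurrent_colours (s l d N : nat) (V : finType) (F : kgraph (l + d) V)
    (col : V -> nat) :
  (1 < l)%N -> (1 < N)%N -> (l * (l.+1 + d) <= s)%N -> recurrent s l d F ->
  (forall v, col v < N)%N -> (forall e, e \in edges F -> admissible N l col e) ->
  (N <= #|V|)%N.
Proof.
move=> l1 N1 sbig [P [/set0Pn[p0 p0P] Pinj Pstep]] colN adm.
have s0 : (0 < s)%N by nia.
have ls : (l <= s)%N by nia.
pose mono (p : {ffun 'I_s -> V}) x := forall i, col (p i) = x.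
have mult_im p x (S : {set 'I_s}) : p \in P ->
    mult col (p @: S)%SET x = #|[set i in S | col (p i) == x]%SET|.
  move=> /Pinj pinj; rewrite -(card_imset _ pinj); congr #|pred_of_set _|; apply/setP => v.
  rewrite inE; apply/andP/imsetP => [[/imsetP[i iS ->] ix]|[i]].
    by exists i; rewrite // inE iS.
  by rewrite inE => /andP[iS ix] ->; rewrite imset_f.
have step p x (S : {set 'I_s}) : p \in P -> #|S| = l -> (x < N)%N ->
    (forall i, i \in S -> col (p i) = x) ->
    exists2 q, q \in P & mono q (x.+1 %% N)%N.
  move=> pP Sl xN Sx; have [q qP qF] := Pstep p S pP Sl.
  apply: contrapT => noq.
  have /fin_all_exists[a aP] : forall j, exists i, col (q j i) != (x.+1 %% N)%N.
    move=> j; apply: contrapT => noi; apply: noq; exists (q j) => // i.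
    by apply/eqP/negP => /negP qi; apply: noi; exists i.
  have /andP[/forallP/(_ (Ordinal xN))/implyP next _] := adm _ (qF a).
  have /mult_gt0P[v] : (0 < mult col (p @: S :|: [set q j (a j) | j in 'I_d])%SET (x.+1 %% N))%N.
    apply: next; rewrite /= -[X in (X <= _)%N]Sl -(card_imset _ (Pinj p pP)).
    apply/subset_leq_card/fintype.subsetP => v vS; rewrite !inE vS /=.
    by case/imsetP: vS => i /Sx <- ->.
  rewrite inE => /orP[/imsetP[i /Sx ix ->]|/imsetP[j _ ->]].
    rewrite ix; case: (ltnP x.+1 N) => xN'; first by rewrite modn_small //; lia.
    have xN1 : x.+1 = N by apply/eqP; rewrite eqn_leq xN xN'.
    by rewrite xN1 modnn => x0; move: N1; rewrite -xN1 x0.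
  by move=> qj; have := aP j; rewrite qj eqxx.
have start : exists p x (S : {set 'I_s}), [/\ p \in P, #|S| = l, (x < N)%N &
    forall i, i \in S -> col (p i) = x].
  apply: contrapT => none.
  have few p x : p \in P -> (#|[set i | col (p i) == x]%SET| < l)%N.
    move=> pP; rewrite ltnNge; apply/negP => /subset_of_card[S /fintype.subsetP SP Sl].
    apply: none; have l0 : (0 < #|S|)%N by lia.
    case/card_gt0P: l0 => i0 i0S; have := SP _ i0S; rewrite inE => /eqP i0x.
    exists p, x, S; split=> //; first by rewrite -i0x.
    by move=> i /SP; rewrite inE => /eqP.
  have [S SP Sl] : exists2 S : {set 'I_s}, S \subset [set i | col (p0 i) != 0%N]%SET & #|S| = l.
    apply: subset_of_card; have := few p0 0%N p0P.
    have := cardsC [set i | col (p0 i) == 0%N]%SET; rewrite card_ord.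
    have -> : (~: [set i | col (p0 i) == 0%N] = [set i | col (p0 i) != 0%N])%SET.
      by apply/setP => i; rewrite !inE.
    have l2s : (l + l <= s)%N by nia.
    move=> total zeros; apply: leq_trans (_ : s - l <= _)%N; first by lia.
    by rewrite leq_subLR -[X in (X <= _)%N]total leq_add2r ltnW.
  have [q qP qF] := Pstep p0 S p0P Sl.
  pose C := (0%N :: [seq col (p0 i) | i <- enum S]).
  have [|j x|a ainj aC] := @rainbow_choice s l d (fun j i => col (q j i)) C _ s0.
  - by rewrite /= size_map -cardE Sl.
  - exact: few.
  have /andP[_ /orP[/existsP[x]|/mult_gt0P[v]]] := adm _ (qF a).
    apply/negP; rewrite -ltnNge.
    apply: leq_ltn_trans (mult_setU_fresh x _ ainj) _.
      move=> j w /imsetP[i iS ->]; apply: contraNneq (aC j) => <-.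
      by rewrite inE map_f ?orbT // mem_enum.
    rewrite gtn_max l1 /= mult_im //; apply: leq_ltn_trans (few p0 x p0P).
    by apply/subset_leq_card/fintype.subsetP => i; rewrite !inE => /andP[].
  rewrite inE => /orP[/imsetP[i /(fintype.subsetP SP) iS ->]|/imsetP[j _ ->]] v0.
    by move: iS; rewrite inE v0.
  by have := aC j; rewrite inE v0 eqxx.
have [p [x [S [pP Sl xN Sx]]]] := start.
have cycle t : exists2 q, q \in P & mono q ((x.+1 + t) %% N)%N.
  elim: t => [|t [q qP qx]]; first by rewrite addn0; apply: step Sx.
  have : (l <= #|[set: 'I_s]%SET|)%N by rewrite cardsT card_ord.
  case/subset_of_card => T _ Tl.
  have [|q' q'P q'x] := step q _ T qP Tl _ (fun i _ => qx i); first by rewrite ltn_mod; lia.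
  exists q' => // i; rewrite q'x -addn1 modnDml; congr (_ %% _)%N; lia.
(* From x+1, a suitable number of steps leads to any y, modulo N. *)
have /fin_all_exists[v vy] : forall y : 'I_N, exists v, col v = y.
  move=> y; have [q _ qx] := cycle (y + N * x.+1 - x.+1)%N.
  exists (q (Ordinal s0)); rewrite qx subnKC; last by nia.
  by rewrite mulnC addnC modnMDl modn_small.
have vinj : injective v by move=> y y' /(congr1 col); rewrite !vy => /val_inj.
by rewrite -[X in (X <= _)%N](card_ord N); apply: leq_card vinj.
Qed.

(** A copy of F in the pattern graph carries the residue colouring back to F, where all
edges become admissible. *)
Lemma pattern_free (s l d N n : nat) (V : finType) (F : kgraph (l + d) V) :
  (1 < l)%N -> (1 < N)%N -> (l * (l.+1 + d) <= s)%N -> recurrent s l d F ->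
  (#|V| < N)%N -> is_free F (pattern_graph N l (l + d) n).
Proof.
move=> l1 N1 sbig Frec VN; apply/negP => /existsP[f /andP[/injectiveP finj /forall_inP fF]].
move: VN; rewrite ltnNge => /negP; apply.
apply: (recurrent_colours (col := fun v => f v %% N)%N l1 N1 sbig Frec) => [v|e /fF].
  by rewrite ltn_mod; lia.
rewrite edges_kgraph_of => /andP[_].
rewrite /admissible (_ : mult _ (f @: e)%SET = mult (fun v => f v %% N)%N e) //.
apply/funext => x; rewrite /mult -[RHS](card_imset _ finj); congr #|pred_of_set _|.
apply/setP => w; rewrite inE; apply/andP/imsetP => [[/imsetP[v ve ->] vx]|[v]].
  by exists v; rewrite // inE ve.
by rewrite inE => /andP[ve vx] ->; rewrite imset_f.
Qed.

Lemma pattern_density (R : realType) (N l d n : nat) (S : {set 'I_n}) :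
  (1 < l)%N -> (0 < d)%N -> (l + d <= N)%N -> (N <= n)%N -> #|S| = l ->
  ((2 * N) ^ d)%:R^-1 * 'C(n - l, d)%:R <= (degree (pattern_graph N l (l + d) n) S)%:R :> R.
Proof.
move=> l1 d0 ldN Nn Sl; have N0 : (0 < N)%N by lia.
rewrite mulrC ler_pdivrMr ?ltr0n ?expn_gt0 ?muln_gt0 ?N0 // -natrM ler_nat.
apply: leq_trans (_ : (n %/ N) ^ d * (2 * N) ^ d <= _)%N; last first.
  by rewrite leq_mul2r (pattern_degree l1 d0 ldN Sl) orbT.
rewrite -expnMn; apply: leq_trans (_ : (n - l) ^_ d <= _)%N.
  by rewrite -bin_ffact leq_pmulr ?fact_gt0.
apply: leq_trans (ffact_le_expn d (leq_subr l n)) _; rewrite leq_exp2r //.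
have := divn_eq n N; have := ltn_pmod n N0; have : (0 < n %/ N)%N by rewrite divn_gt0.
nia.
Qed.

Lemma recurrent_density_gt0 (R : realType) (s l d : nat) (V : finType)
    (F : kgraph (l + d) V) :
  (1 < l)%N -> (0 < d)%N -> (l * (l.+1 + d) <= s)%N -> recurrent s l d F ->
  0 < limn (ex_ratio R l F).
Proof.
move=> l1 d0 sbig Frec; pose N := (#|V|.+1 + (l + d))%N.
have N0 : (0 < N)%N by rewrite /N; lia.
apply: (@lt_le_trans _ _ ((2 * N) ^ d)%:R^-1).
  by rewrite invr_gt0 ltr0n expn_gt0 muln_gt0 N0.
apply: limr_ge; first exact: ex_ratio_cvg.
exists N => // n /= Nn.
have [|S Sl degS] := @min_degree_attained l _ _ (pattern_graph N l (l + d) n).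
  by rewrite card_ord; lia.
have Cn : 0 < 'C(n - l, d)%:R :> R by rewrite ltr0n bin_gt0; lia.
rewrite /ex_ratio addKn ler_pdivlMr //.
apply: le_trans (pattern_density R l1 d0 _ Nn Sl) _; first by lia.
rewrite -degS ler_nat; apply/min_degree_le_ex/(pattern_free _ l1 _ sbig Frec); lia.
Qed.

(** * Products of rich hypergraphs *)

Definition rich (s l d m : nat) (G : kgraph (l + d) 'I_m) : bool :=
  `[< forall S : {set 'I_m}, #|S| = l ->
      exists2 q : 'I_d -> 'I_s -> 'I_m, forall j, injective (q j) &
        forall a : 'I_d -> 'I_s, (S :|: [set q j (a j) | j in 'I_d])%SET \in edges G >].

(** The link of an l-set, seen as a set of d-tuples, is dense and hence contains a
box. *)
Lemma rich_of_degree (R : realType) (s l d : nat) (eps : R) :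
  (0 < d)%N -> 0 < eps -> eps <= 1 ->
  exists m0 : nat, forall m : nat, (m0 <= m)%N -> forall G : kgraph (l + d) 'I_m,
  (forall S : {set 'I_m}, #|S| = l -> eps * 'C(m - l, d)%:R <= (degree G S)%:R) ->
  rich s G.
Proof.
move=> d0 eps0 eps1; pose C := (Num.trunc (2 / eps)).+1.
have [n1 n1P] := dense_box d s C.
exists (maxn n1 (Num.trunc ((d * (l + d))%:R / (eps / 2))).+1) => m.
rewrite geq_max => /andP[n1m mbig] G degG; apply/asboolP => S Sl.
have e0 : 0 < eps / 2 by lra.
have mbig' : (d * (l + d))%:R <= (eps / 2) * m%:R.
  rewrite mulrC -ler_pdivrMr //; apply: le_trans (ltW (truncnS_gt _)) _.
  by rewrite ler_nat.
have dens : (eps / 2) * (m ^ d)%:R <= #|link_tuples d G S|%:R.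
  have m0 : (0 < m)%N by apply: leq_trans mbig.
  have := link_density m0 e0 eps1 mbig'; rewrite (_ : eps - eps / 2 = eps / 2); last by field.
  move=> /le_trans; apply.
  by rewrite card_link_tuples // !natrM mulrCA ler_wpM2l ?ler0n ?degG.
have [||q qinj qbox] := n1P 'I_m _ (link_tuples d G S).
- by rewrite card_ord.
- rewrite card_ord -(ler_nat R) natrM.
  have C2 : 2 / eps <= C%:R by apply/ltW/truncnS_gt.
  apply: le_trans (_ : 2 / eps * #|link_tuples d G S|%:R <= _); last first.
    by rewrite ler_wpM2r ?ler0n.
  rewrite -ler_pdivrMl; last by rewrite divr_gt0.
  by rewrite invf_div.
exists q => // a; have := qbox a; rewrite inE.
by rewrite (eq_imset _ (fun j => ffunE _ j)).
Qed.

Definition rich_product (s l d m : nat) :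
    kgraph (l + d) {ffun kgraph (l + d) 'I_m -> 'I_m} :=
  kgraph_of (l + d) (fun e : {set {ffun kgraph (l + d) 'I_m -> 'I_m}} =>
    [forall (G : kgraph (l + d) 'I_m | rich s G),
      [set x G | x : {ffun kgraph (l + d) 'I_m -> 'I_m} in e]%SET \in edges G]).

(** The states are the s-tuples all of whose projections to rich factors are injective;
completions are chosen independently in each factor.  The factor G0 guarantees that
the resulting sets have k elements. *)
Lemma rich_product_recurrent (s l d m : nat) (G0 : kgraph (l + d) 'I_m) :
  (s <= m)%N -> rich s G0 -> recurrent s l d (rich_product s l d m).
Proof.
move=> sm richG0; pose V := {ffun kgraph (l + d) 'I_m -> 'I_m}.
pose P := [set p : {ffun 'I_s -> V} | [forall (G | rich s G), injectiveb [ffun i => p i G]]]%SET.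
have PP p G : p \in P -> rich s G -> injective (fun i => p i G).
  rewrite inE => /forall_inP pP /pP /injectiveP pinj i i' ii'.
  by apply: pinj; rewrite !ffunE.
exists P; split.
(* An initial state: the diagonal copies of the first s vertices. *)
- apply/set0Pn; exists [ffun i => [ffun=> widen_ord sm i]]; rewrite inE.
  apply/forall_inP => G _; apply/injectiveP => i i'; rewrite !ffunE => /(congr1 val) /= ii'.
  exact: val_inj.
- by move=> p pP i i' ii'; apply: (PP p G0 pP richG0); rewrite ii'.
move=> p S pP Sl.
have /fin_all_exists[q qP] : forall G : kgraph (l + d) 'I_m,
    exists q : 'I_d -> 'I_s -> 'I_m, rich s G -> (forall j, injective (q j)) /\
    forall a : 'I_d -> 'I_s,
      ([set p i G | i in S] :|: [set q j (a j) | j in 'I_d])%SET \in edges G.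
  move=> G; have [richG|] := boolP (rich s G); last first.
    by exists (fun _ => widen_ord sm).
  have SG : #|[set p i G | i in S]%SET| = l by rewrite card_imset //; apply: PP.
  by have /asboolP/(_ _ SG)[q qinj qF] := richG; exists q.
exists (fun j => [ffun i => [ffun G => q G j i]]) => [j|a].
  rewrite inE; apply/forall_inP => G /qP[qinj _]; apply/injectiveP => i i'.
  by rewrite !ffunE => /qinj.
set e := (_ :|: _)%SET.
have proj (G : kgraph (l + d) 'I_m) : rich s G -> [set x G | x : V in e]%SET \in edges G.
  move=> /qP[_ qF].
  suff -> : [set x G | x : V in e]%SET =
      ([set p i G | i in S] :|: [set q G j (a j) | j in 'I_d])%SET by apply: qF.
  rewrite /e imsetU -!imset_comp; congr (_ :|: _)%SET.
  by apply: eq_imset => j; rewrite /= !ffunE.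
rewrite edges_kgraph_of; apply/andP; split; last exact/forall_inP.
rewrite eqn_leq; apply/andP; split.
  rewrite /e; apply: leq_trans (leq_card_setU _ _) _; apply: leq_add.
    by rewrite -[X in (_ <= X)%N]Sl leq_imset_card.
  by rewrite -[X in (_ <= X)%N](card_ord d) leq_imset_card.
have cG0 := card_edge (proj G0 richG0).
by apply: leq_trans (leq_imset_card (fun x : V => x G0) e); rewrite cG0.
Qed.

(** The vertex x goes to the q-class of its coordinate at G, to a place in that class
encoding x itself.  An edge of the product has distinct coordinates at G, so that it
is the image of an edge of G by a single transversal of the box. *)
Lemma rich_product_in_box (s l d m t : nat) (W : finType) (H : kgraph (l + d) W)
    (G : kgraph (l + d) 'I_m) (q : 'I_m -> 'I_t -> W) :
  (0 < m)%N -> t = #|{: {ffun kgraph (l + d) 'I_m -> 'I_m}}| ->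
  rich s G -> (forall i, injective (q i)) ->
  (forall a : 'I_m -> 'I_t, let g := [ffun i => q i (a i)] in
     injective g /\ pullback g H = G) ->
  ~~ is_free (rich_product s l d m) H.
Proof.
move=> m0 tE richG qinj qbox; rewrite negbK; pose V := {ffun kgraph (l + d) 'I_m -> 'I_m}.
pose rk (x : V) : 'I_t := cast_ord (esym tE) (enum_rank x).
have rk_inj : injective rk by move=> x y /cast_ord_inj/enum_rank_inj.
pose f := [ffun x : V => q (x G) (rk x)].
have t0 : (0 < t)%N by rewrite tE; apply/card_gt0P; exists [ffun=> Ordinal m0].
have transversal (e : {set V}) : {in e &, injective (fun x : V => x G)} ->
    exists a : 'I_m -> 'I_t, forall x, x \in e -> a (x G) = rk x.
  move=> einj.
  exists (fun i => if [pick x in e | x G == i] is Some x then rk x else Ordinal t0) => x xe.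
  case: pickP => [y /andP[ye /eqP yx]|/(_ x)]; last by rewrite xe eqxx.
  by congr rk; apply: einj.
apply/existsP; exists f; apply/andP; split.
  apply/injectiveP => x y; rewrite !ffunE => fxy.
  have [xy|xy] := eqVneq (x G) (y G).
    by apply: rk_inj; apply: (qinj (x G)); rewrite fxy xy.
  have [|a aP] := transversal [set x; y]%SET.
    move=> u v; rewrite !inE => /orP[] /eqP-> /orP[] /eqP-> // h; case/eqP: xy => //.
  have [ginj _] := qbox a; case/eqP: xy; apply: ginj.
  by rewrite !ffunE !aP ?inE ?eqxx ?orbT.
apply/forall_inP => e; rewrite edges_kgraph_of => /andP[/eqP ecard /forall_inP/(_ G richG) eG].
have einj : {in e &, injective (fun x : V => x G)}.
  by apply/imset_injP; rewrite ecard (card_edge eG).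
have [a aP] := transversal e einj.
have [_ gG] := qbox a; move: eG; rewrite -[X in _ \in edges X]gG edges_kgraph_of => /andP[_].
have -> : ([ffun i => q i (a i)] @: [set x G | x : V in e] = f @: e)%SET; last by [].
by rewrite -imset_comp; apply: eq_in_imset => x xe; rewrite /= !ffunE aP.
Qed.

(** Among the finitely many rich hypergraphs on m vertices, one is the pullback along a
positive proportion of all maps; [dense_box] then applies to these maps. *)
Lemma rich_product_upper (R : realType) (s l d : nat) (eps : R) :
  (0 < d)%N -> 0 < eps -> eps <= 1 ->
  exists m0 : nat, forall m : nat, (m0 <= m)%N ->
  exists n0 : nat, forall n : nat, (n0 <= n)%N ->
  ex_ratio R l (rich_product s l d m) n <= eps.
Proof.
move=> d0 eps0 eps1; have e0 : 0 < eps / 2 by lra.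
have e1 : eps / 2 <= 1 by lra.
have [m1 m1P] := @sampling R l d _ d0 e0.
have [m2 m2P] := @rich_of_degree R s l d _ d0 e0 e1.
exists (maxn (maxn m1 m2) 1) => m; rewrite !geq_max => /andP[/andP[/m1P[n1 n1P] /m2P mrich] m0].
pose K := #|[pred G : kgraph (l + d) 'I_m | rich s G]|.
pose t := #|{: {ffun kgraph (l + d) 'I_m -> 'I_m}}|.
have [n2 n2P] := dense_box m t (2 * K).
exists (maxn (maxn n1 n2) (l + d)) => n; rewrite !geq_max => /andP[/andP[n1n n2n] ldn].
rewrite leNgt; apply/negP => big.
have Cn : 0 < 'C(n - l, d)%:R :> R by rewrite ltr0n bin_gt0; lia.
have ex_gt0 : (0 < ex l n (rich_product s l d m))%N.
  rewrite lt0n; apply/negP => /eqP ex0; move: big.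
  by rewrite /ex_ratio ex0 mul0r ltNge ltW.
have [H Hfree Hdeg] := ex_attained ex_gt0.
have degH (S : {set 'I_n}) : #|S| = l -> eps * 'C(#|'I_n| - l, d)%:R <= (degree H S)%:R.
  move=> Sl; rewrite card_ord; move: big; rewrite /ex_ratio addKn ltr_pdivlMr // => /ltW.
  by move=> /le_trans; apply; rewrite ler_nat -Hdeg min_degree_le.
have := n1P 'I_n; rewrite card_ord => /(_ n1n H _ eps1).
rewrite card_ord in degH; move=> /(_ degH); set good := [set g | _]%SET => count.
pose B (G : kgraph (l + d) 'I_m) :=
  [set g : {ffun 'I_m -> 'I_n} | injectiveb g && (pullback g H == G)]%SET.
have cover : (#|good| <= \sum_(G : kgraph (l + d) 'I_m | rich s G) #|B G|)%N.
  apply: union_bound => g; rewrite inE => /andP[ginj /forall_inP gdeg].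
  exists (pullback g H); last by rewrite inE ginj eqxx.
  apply: mrich => S Sl; rewrite (_ : eps / 2 = eps - eps / 2); last by field.
  by apply: gdeg; apply/eqP.
have good0 : (0 < #|good|)%N.
  have nm : (0 < n ^ m)%N by rewrite expn_gt0; apply/orP; left; lia.
  by have := leq_trans nm count; rewrite muln_gt0.
have [G richG GB] := pigeonhole_sum good0 cover.
have [||q qinj qbox] := n2P 'I_n _ (B G).
- by rewrite card_ord.
- by rewrite card_ord -mulnA; apply: leq_trans count _; rewrite leq_mul2l.
have boxG (a : 'I_m -> 'I_t) : let g := [ffun i => q i (a i)] in
    injective g /\ pullback g H = G.
  by have := qbox a; rewrite inE => /andP[/injectiveP ginj /eqP gG].
by have := rich_product_in_box m0 erefl richG qinj boxG; rewrite Hfree.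
Qed.

(** The pattern graphs have positive density. *)
Lemma exists_rich (R : realType) (s l d : nat) : (1 < l)%N -> (0 < d)%N ->
  exists m0 : nat, forall m : nat, (m0 <= m)%N ->
  exists G : kgraph (l + d) 'I_m, rich s G.
Proof.
move=> l1 d0; pose N := (l + d)%N; pose c : R := ((2 * N) ^ d)%:R^-1.
have N0 : (0 < N)%N by rewrite /N; lia.
have pow0 : (0 < (2 * N) ^ d)%N by rewrite expn_gt0 muln_gt0 N0.
have c0 : 0 < c by rewrite invr_gt0 ltr0n.
have c1 : c <= 1 by rewrite invf_le1 ?ltr0n // ler1n.
have [m1 m1P] := @rich_of_degree R s l d c d0 c0 c1.
exists (maxn m1 N) => m; rewrite geq_max => /andP[/m1P mrich Nm].
exists (pattern_graph N l (l + d) m); apply: mrich => S Sl.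
exact: pattern_density.
Qed.

(** * Accumulation at zero *)

Theorem theorem1p9 (R : realType) (k l : nat) (hl : (2 <= l)%N) (hk : (l < k)%N) :
  limit_point (turan_densities R l k) (0%R : R).
Proof.
have [d d0 kE] : exists2 d, (0 < d)%N & k = (l + d)%N by exists (k - l)%N; lia.
subst k; pose s := (l * (l.+1 + d))%N.
move=> U /nbhs_ballP[e /= e0 ballU].
pose eps : R := Num.min (e / 2) 1.
have eps0 : 0 < eps by rewrite lt_min ltr01 andbT divr_gt0.
have eps1 : eps <= 1 by rewrite ge_min lexx orbT.
have [m1 m1P] := @rich_product_upper R s l d eps d0 eps0 eps1.
have [m2 m2P] := exists_rich R s hl d0.
pose m := maxn (maxn m1 m2) s.
have [n0 n0P] : exists n0 : nat, forall n : nat, (n0 <= n)%N ->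
    ex_ratio R l (rich_product s l d m) n <= eps.
  by apply: m1P; rewrite /m !leq_max leqnn.
have [G0 richG0] : exists G : kgraph (l + d) 'I_m, rich s G.
  by apply: m2P; rewrite /m !leq_max leqnn orbT.
have Frec : recurrent s l d (rich_product s l d m).
  by apply: rich_product_recurrent richG0; rewrite leq_max leqnn orbT.
have Fcvg := @ex_ratio_cvg R l d _ (rich_product s l d m) d0.
have pi_gt0 := recurrent_density_gt0 R hl d0 (leqnn _) Frec.
have pi_le : limn (ex_ratio R l (rich_product s l d m)) <= eps.
  by apply: limr_le => //; exists n0.
exists (turan_density R l (rich_product s l d m)); split.
- by rewrite gt_eqF.
- by exists _, (rich_product s l d m).
apply: ballU; rewrite /ball /= sub0r normrN gtr0_norm //.
apply: le_lt_trans pi_le _; rewrite gt_min; apply/orP; left; lra.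
Qed.
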